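(* Let $F$ be a divisible $\nu$-archimedean $\nu$-semifield$^\dagger$ and $F(\Lambda)=F(\lambda_1,\dots,\lambda_n)$. If $L\in\mathrm{HSpec}(F(\Lambda))$, then $\mathrm{hgt}(L)=d_{\mathrm{conv}}(L)$. Moreover, every factor of a descending chain of HS-kernels (descending from $L$) of maximal length is an HP-kernel.
   Context: **Setting.** A semiring$^\dagger$ $(R,+,\cdot,1)$ is a semiring without zero: $(R,+)$ is an abelian semigroup, $(R,\cdot,1)$ a monoid, multiplication distributes over addition, and some $r_0,r_1\in R$ satisfy $r_0+r_1=1$. A $\nu$-domain$^\dagger$ is a quadruple $(R,\mathcal T,\nu,\mathcal G)$ with $R$ a semiring$^\dagger$, $\mathcal T\subset R$ a cancellative multiplicative submonoid (tangible elements), $\mathcal G$ an ideal of $R$ (ghosts) with a partial order, and $\nu:R\to\mathcal G$ an idempotent homomorphism with $\nu|_{\mathcal T}$ onto, such that $a+b=a$ if $\nu(a)>\nu(b)$ and $a+b=\nu(a)$ if $\nu(a)=\nu(b)$. It is a $\nu$-semifield$^\dagger$ if $\mathcal T$ is an abelian group. Write $a\cong_\nu b$ if $\nu(a)=\nu(b)$, and $a\ge_\nu b$ if $\nu(a)\ge\nu(b)$. $F$ is a $\nu$-archimedean (for $\alpha>_\nu1$ and any $\beta$, some $\alpha^k>_\nu\beta$), divisible $\nu$-semifield$^\dagger$. $F(\Lambda)$ is the $\nu$-semifield$^\dagger$ of fractions of the polynomial semiring$^\dagger$ $F[\Lambda]$, $\Lambda=\{\lambda_1,\dots,\lambda_n\}$;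 its elements are viewed as functions $F^{(n)}\to F$, and only those of the form $h/g$ with $h,g$ having tangible coefficients are used. Relations are understood up to $\cong_\nu$; $|f|=f+f^{-1}$. **Kernels.** A kernel of a $\nu$-semifield$^\dagger$ $\mathcal S$ is a multiplicative subgroup $K$ such that $a,b\in K$, $\alpha,\beta\in\mathcal S$, $\alpha+\beta\cong_\nu1$ imply $\alpha a+\beta b\in K$. The quotient $\mathcal S/K$ is by the congruence $a\equiv b$ iff $ab^{-1}\in K$ (up to $\nu$). $\langle S\rangle$ is the smallest kernel containing $S$; $K_1\cdot K_2=\{ab:a\in K_1,b\in K_2\}$ is a kernel. A principal kernel is one of the form $\langle f\rangle$. $\langle F\rangle$ is the kernel of $F(\Lambda)$ generated by any $\alpha\in F$ with $\alpha\not\cong_\nu1$. Write $f\sim_{\langle F\rangle}f'$ if $\langle f\rangle\cap\langle F\rangle=\langle f'\rangle\cap\langle F\rangle$. **Special kernels.** An $\mathscr L$-monomial is a non-constant Laurent monomial $f=h/g$, with $h,g\in F[\Lambda]$ non-proportional monomials. An HP-kernel is a principal kernel generated by an $\mathscr L$-monomial. An HS-fraction is $f\in F(\Lambda)$ with $f\sim_{\langle F\rangle}\sum_{i=1}^t|f_i|$ for non-proportional $\mathscr L$-monomials $f_i$; an HS-kernel is a principal kernel generated by an HS-fraction, the trivial kernel $\langle1\rangle$ being counted as an HS-kernel. $\Omega(F(\Lambda))$ is the lattice of kernels obtained from HP-kernels by finite intersections and products. $\langle f\rangle\in\Omega(F(\Lambda))$ is reducible if there are $\langle g\rangle,\langle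 h\rangle\in\Omega(F(\Lambda))$ with $\langle g\rangle,\langle h\rangle\not\subseteq\langle f\rangle$ but $\langle g\rangle\cap\langle h\rangle\subseteq\langle f\rangle$; otherwise irreducible. $\mathrm{HSpec}(F(\Lambda))$ is the family of irreducible kernels in $\Omega(F(\Lambda))$; it coincides with the family of HS-kernels. **Height and factors.** A chain $P_0\subset P_1\subset\dots\subset P_t$ (strict inclusions) in $\mathrm{HSpec}(F(\Lambda))$ has length $t$. $\mathrm{hgt}(P)=t$ if there is a chain of length $t$ in $\mathrm{HSpec}(F(\Lambda))$ terminating at $P$ (i.e. with largest member $P$) but none of length $t+1$. The factors of a chain are the kernels $P_i/P_{i-1}$ of $F(\Lambda)/P_{i-1}$; an HP-kernel of a quotient $F(\Lambda)/M$ is a principal kernel generated by the image, not lying in (the image of) $F$, of an $\mathscr L$-monomial. **Convex dimension.** $\mathrm{HP}(F(\Lambda))$ is the set of $\mathscr L$-monomials. An element $f$ is $F$-convexly dependent on a set $A$ if $f\in\langle A\rangle\cdot\langle F\rangle$; a set $A$ is $F$-convexly independent if no $f\in A$ is $F$-convexly dependent on $A\setminus\{f\}$. A basis of a set $V\subset\mathrm{HP}(F(\Lambda))$ is a maximal $F$-convexly independent subset of $V$; all bases have the same cardinality. For a kernel $K$ of $F(\Lambda)$, $d_{\mathrm{conv}}(K)$ is the cardinality of a basis of the convex span $\{a\in\mathrm{HP}(F(\Lambda)):a\text{ is }F\text{-convexly dependent on }K\}$.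
   Formalization: Members of HSpec are required to be proper, i.e. to contain no constant except 1 up to ν (else L=⟨x⟩⟨cx⟩ has height 2 and convex dimension 1); the order on the ghosts is taken to be the one given by their addition. *)

(* Defs.v *)
From mathcomp Require Import all_boot.
From mathcomp Require Import boolp classical_sets functions cardinality.

Set Implicit Arguments.
Unset Strict Implicit.
Unset Printing Implicit Defensive.

Local Open Scope classical_set_scope.

Record semiringDagger := SemiringDagger {
  sr_sort :> Type;
  sadd : sr_sort -> sr_sort -> sr_sort;
  smul : sr_sort -> sr_sort -> sr_sort;
  sone : sr_sort;
  saddA : forall a b c, sadd a (sadd b c) = sadd (sadd a b) c;
  saddC : forall a b, sadd a b = sadd b a;
  smulA : forall a b c, smul a (smul b c) = smul (smul a b) c;
  smul1l : forall a, smul sone a = a;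
  smul1r : forall a, smul a sone = a;
  smulDl : forall a b c, smul (sadd a b) c = sadd (smul a c) (smul b c);
  smulDr : forall a b c, smul a (sadd b c) = sadd (smul a b) (smul a c);
  sone_split : exists r0 r1, sadd r0 r1 = sone
}.

Arguments sone {s}.

Definition spow (R : semiringDagger) (a : R) (k : nat) : R :=
  iter k (smul a) sone.

Record nuDomain := NuDomain {
  nd_sort :> semiringDagger;
  tangible : set nd_sort;
  ghost : set nd_sort;
  nu : nd_sort -> nd_sort;
  (* the order of the ghost ideal; only its values on ghosts matter *)
  gle : nd_sort -> nd_sort -> Prop;
  tangible1 : tangible sone;
  tangibleM : forall a b, tangible a -> tangible b -> tangible (smul a b);
  tangible_lreg : forall a b c, tangible a -> tangible b -> tangible c ->
    smul a b = smul a c -> b = c;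
  tangible_rreg : forall a b c, tangible a -> tangible b -> tangible c ->
    smul b a = smul c a -> b = c;
  ghostD : forall g h, ghost g -> ghost h -> ghost (sadd g h);
  ghostMl : forall a g, ghost g -> ghost (smul a g);
  ghostMr : forall a g, ghost g -> ghost (smul g a);
  gle_refl : forall g, ghost g -> gle g g;
  gle_anti : forall g h, ghost g -> ghost h -> gle g h -> gle h g -> g = h;
  gle_trans : forall g h k, ghost g -> ghost h -> ghost k ->
    gle g h -> gle h k -> gle g k;
  (* The order is the one of the idempotent addition of the ghosts (the
     converse implication follows from [nu_gt_add] and [nu_eq_add]).  Without
     this link the order could be equality, and being nu-archimedean would be
     a vacuous condition. *)
  gle_add : forall g h, ghost g -> ghost h -> sadd g h = g -> gle h g;
  nu_ghost : forall a, ghost (nu a);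
  nu_idem : forall a, nu (nu a) = nu a;
  nuD : forall a b, nu (sadd a b) = sadd (nu a) (nu b);
  nuM : forall a b, nu (smul a b) = smul (nu a) (nu b);
  nu_onto : forall g, ghost g -> exists2 a, tangible a & nu a = g;
  nu_gt_add : forall a b, gle (nu b) (nu a) -> nu a <> nu b -> sadd a b = a;
  nu_eq_add : forall a b, nu a = nu b -> sadd a b = nu a
}.

Arguments tangible {n} _.
Arguments ghost {n} _.

Record nuSemifield := NuSemifield {
  ns_sort :> nuDomain;
  tangibleC : forall a b : ns_sort, tangible a -> tangible b ->
    smul a b = smul b a;
  tangibleV : forall a : ns_sort, tangible a ->
    exists2 b, tangible b & smul a b = sone
}.

Definition nu_eq (R : nuDomain) (a b : R) : Prop := nu a = nu b.
Definition nu_ge (R : nuDomain) (a b : R) : Prop := gle (nu b) (nu a).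
Definition nu_gt (R : nuDomain) (a b : R) : Prop := nu_ge a b /\ ~ nu_eq a b.

Definition nu_archimedean (F : nuSemifield) : Prop :=
  forall a b : F, nu_gt a sone -> exists k, nu_gt (spow a k) b.

Definition nu_divisible (F : nuSemifield) : Prop :=
  forall (a : F) (k : nat), 0 < k -> exists b : F, nu_eq (spow b k) a.

(* F(Lambda) and its quotients are used through their operations and the
   relation [eqv] that plays the role of equality in them: equality up to nu
   in F(Lambda), congruence modulo K in the quotient by K. *)
Record semifieldSetoid := SemifieldSetoid {
  sf_sort :> Type;
  eqv : sf_sort -> sf_sort -> Prop;
  fadd : sf_sort -> sf_sort -> sf_sort;
  fmul : sf_sort -> sf_sort -> sf_sort;
  fone : sf_sort;
  finv : sf_sort -> sf_sort
}.

Arguments fone {s}.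

Section Kernels.
Variable S : semifieldSetoid.

Record is_kernel (K : set S) : Prop := IsKernel {
  ker_eqv : forall a b, eqv a b -> K a -> K b;
  ker1 : K fone;
  kerM : forall a b, K a -> K b -> K (fmul a b);
  kerV : forall a, K a -> K (finv a);
  ker_conv : forall a b u v, K a -> K b -> eqv (fadd u v) fone ->
    K (fadd (fmul u a) (fmul v b))
}.

Definition kgen (A : set S) : set S :=
  [set a | forall K, is_kernel K -> A `<=` K -> K a].

Definition kprod (K1 K2 : set S) : set S :=
  [set c | exists a b, [/\ K1 a, K2 b & eqv c (fmul a b)]].

Definition quot (K : set S) : semifieldSetoid :=
  @SemifieldSetoid S (fun a b => K (fmul a (finv b)))
    (@fadd S) (@fmul S) fone (@finv S).

Definition quot_image (M P : set S) : set (quot M) :=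
  [set a | exists2 b : S, P b & @eqv (quot M) a b].

End Kernels.

Arguments quot_image {S} M P.

Section RationalFunctions.
Variables (F : nuSemifield) (n : nat).

Definition tang := {c : F | tangible c}.

Definition tang1 : tang := exist _ sone (@tangible1 F).

Definition tangM (a b : tang) : tang :=
  exist _ (smul (sval a) (sval b)) (tangibleM (proj2_sig a) (proj2_sig b)).

Definition point := 'I_n -> F.

Record monomial := Monomial {
  mcoef : tang;
  mexp : {ffun 'I_n -> nat}
}.

Definition meval (m : monomial) (x : point) : F :=
  smul (sval (mcoef m))
    (\big[@smul F/sone]_(i < n) spow (x i) (mexp m i)).

Definition mconst (c : tang) : monomial := Monomial c [ffun=> 0].

Definition mmul (m m' : monomial) : monomial :=
  Monomial (tangM (mcoef m) (mcoef m')) [ffun i => mexp m i + mexp m' i].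

(* There is no zero, so a polynomial is a nonempty formal sum of monomials.
   Like terms are not collected, which would create ghost coefficients;
   polynomials are only compared through the functions they define. *)
Inductive polynomial :=
| PMono of monomial
| PAdd of polynomial & polynomial.

Fixpoint peval (p : polynomial) (x : point) : F :=
  match p with
  | PMono m => meval m x
  | PAdd p1 p2 => sadd (peval p1 x) (peval p2 x)
  end.

Fixpoint pmulm (m : monomial) (p : polynomial) : polynomial :=
  match p with
  | PMono m' => PMono (mmul m m')
  | PAdd p1 p2 => PAdd (pmulm m p1) (pmulm m p2)
  end.

Fixpoint pmul (p q : polynomial) : polynomial :=
  match p with
  | PMono m => pmulm m q
  | PAdd p1 p2 => PAdd (pmul p1 q) (pmul p2 q)
  end.

Record fraction := Fraction { fnum : polynomial; fden : polynomial }.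

(* Equality up to nu of the two functions on F^(n).  It is cross-multiplied
   because the value of a denominator may be ghost, hence not invertible
   in F. *)
Definition fraction_eqv (f f' : fraction) : Prop :=
  forall x : point,
    nu_eq (smul (peval (fnum f) x) (peval (fden f') x))
          (smul (peval (fnum f') x) (peval (fden f) x)).

Definition fraction_add (f f' : fraction) : fraction :=
  Fraction (PAdd (pmul (fnum f) (fden f')) (pmul (fnum f') (fden f)))
           (pmul (fden f) (fden f')).

Definition fraction_mul (f f' : fraction) : fraction :=
  Fraction (pmul (fnum f) (fnum f')) (pmul (fden f) (fden f')).

Definition fraction_inv (f : fraction) : fraction := Fraction (fden f) (fnum f).

Definition fconst (c : tang) : fraction :=
  Fraction (PMono (mconst c)) (PMono (mconst tang1)).

Definition FLambda : semifieldSetoid :=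
  @SemifieldSetoid fraction fraction_eqv fraction_add fraction_mul
    (fconst tang1) fraction_inv.

Definition proportional (h g : monomial) : Prop :=
  exists c : tang, forall x : point,
    nu_eq (meval h x) (smul (sval c) (meval g x)).

(* The set HP(F(Lambda)) of L-monomials. *)
Definition Lmonomial : set FLambda :=
  [set f | exists h g : monomial,
     ~ proportional h g /\ @eqv FLambda f (Fraction (PMono h) (PMono g))].

(* The kernel <F>: F being nu-archimedean, it is also generated by any single
   constant that is not equal to 1 up to nu. *)
Definition kerF : set FLambda := kgen (range (fconst : tang -> FLambda)).

(* The trivial kernel is the empty product. *)
Inductive Omega : set FLambda -> Prop :=
| Omega1 : Omega (kgen [set (fone : FLambda)])
| OmegaHP (f : FLambda) : Lmonomial f -> Omega (kgen [set f])
| OmegaI (K1 K2 : set FLambda) : Omega K1 -> Omega K2 -> Omega (K1 `&` K2)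
| OmegaM (K1 K2 : set FLambda) : Omega K1 -> Omega K2 -> Omega (kprod K1 K2).

Definition reducible (K : set FLambda) : Prop :=
  exists g h : FLambda,
    [/\ Omega (kgen [set g]), Omega (kgen [set h]),
        ~ (kgen [set g] `<=` K), ~ (kgen [set h] `<=` K) &
        kgen [set g] `&` kgen [set h] `<=` K].

(* K contains no constant besides 1, i.e. (unless all of F is 1 up to nu) K
   does not contain <F>. *)
Definition F_proper (K : set FLambda) : Prop :=
  forall c : tang, K (fconst c) -> nu_eq (sval c) sone.

(* As in any spectrum the members are proper; here this means not containing
   <F>.  For x = lambda_1 and a constant c other than 1, the product of <x>
   and <c x> contains <F>; it would otherwise count as irreducible, of height
   2 and convex dimension 1, by the chain <1>, <x>, <x><c x>. *)
Definition HSpec (K : set FLambda) : Prop :=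
  [/\ Omega K, ~ reducible K & F_proper K].

(* A chain P 0, ..., P t of length t terminating at L; the values of P beyond
   t are irrelevant. *)
Definition HSchain (L : set FLambda) (t : nat) (P : nat -> set FLambda) : Prop :=
  [/\ forall i, i <= t -> HSpec (P i),
      forall i, i < t -> P i `<` P i.+1 &
      P t = L].

Definition is_hgt (L : set FLambda) (t : nat) : Prop :=
  (exists P, HSchain L t P) /\ ~ (exists P, HSchain L t.+1 P).

Definition HSchain_maximal (L : set FLambda) (t : nat)
    (P : nat -> set FLambda) : Prop :=
  HSchain L t P /\ forall s Q, HSchain L s Q -> s <= t.

Definition HP_kernel_quot (M : set FLambda) (K : set (quot M)) : Prop :=
  exists f : FLambda,
    [/\ Lmonomial f,
        forall c : tang, ~ @eqv (quot M) f (fconst c) &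
        K = @kgen (quot M) [set f : quot M]].

Definition convexly_dependent (A : set FLambda) (f : FLambda) : Prop :=
  kprod (kgen A) kerF f.

Definition convexly_independent (A : set FLambda) : Prop :=
  forall f, A f -> ~ convexly_dependent (A `\ f) f.

Definition convex_basis (V B : set FLambda) : Prop :=
  [/\ B `<=` V, convexly_independent B &
      forall B', B' `<=` V -> convexly_independent B' -> B `<=` B' -> B' = B].

Definition convex_span (K : set FLambda) : set FLambda :=
  [set a | Lmonomial a /\ convexly_dependent K a].

Definition is_dconv (K : set FLambda) (t : nat) : Prop :=
  (exists B, convex_basis (convex_span K) B) /\
  (forall B, convex_basis (convex_span K) B -> (B #= `I_t)%card).

End RationalFunctions.

Arguments HP_kernel_quot {F n} M K.

(* Main.v *)
(* Up to nu, only the ghosts of F matter, and they form a divisible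
   archimedean group, totally ordered because two disjoint positive elements
   cannot dominate each other. By Hoelder's theorem this group embeds in the
   reals as a rational subspace, containing Q unless it is trivial. F(Lambda)
   thereby becomes a lattice-ordered group of piecewise affine functions whose
   kernels are its convex l-subgroups; an L-monomial is a non-constant affine
   function with integral linear part, its slope.

   The kernels in HSpec are then the kernels [flat x0 W], for a point x0 and a
   subspace W of Q^n: the functions bounded by a multiple of the distance to
   the affine subspace x0 + W^perp. Irreducibility in Omega forces an
   intersection of such kernels to be one of them, conversely x0 + W^perp is
   not a finite union of proper subspaces, and not containing <F> means that the
   generating L-monomials have a common zero. Since all members of a chain
   vanish at a zero of the largest one, chains below [flat x0 W] are chains of
   subspaces of W. Finally an L-monomial is F-convexly dependent on others iff
   its slope is in their span, so both dimensions equal dim W. *)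

Require Import Defs.
From HB Require Import structures.
From mathcomp Require Import all_boot all_order all_algebra.
From mathcomp Require Import boolp classical_sets functions cardinality reals Rstruct.
From mathcomp Require Import lra zify.
Import Defs.

Set Implicit Arguments.
Unset Strict Implicit.
Unset Printing Implicit Defensive.

Import Order.TTheory GRing.Theory Num.Theory.

Local Open Scope classical_set_scope.
Local Open Scope ring_scope.

(** * Hoelder's embedding theorem *)

Section Hoelder.
Variables (R : realType) (G : zmodType) (leG : G -> G -> Prop).
Hypothesis leG_anti : forall a b, leG a b -> leG b a -> a = b.
Hypothesis leG_trans : forall a b c, leG a b -> leG b c -> leG a c.
Hypothesis leG_total : forall a b, leG a b \/ leG b a.
Hypothesis leGD2r : forall a b c, leG a b -> leG (a + c) (b + c).
Variable u : G.
Hypothesis u_ge0 : leG 0 u.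
Hypothesis u_neq0 : u <> 0.
Hypothesis arch : forall a b, leG 0 a -> a <> 0 -> exists k, leG b (a *+ k).

Let leG_refl a : leG a a.
Proof. by case: (leG_total a a). Qed.

Let leGD a b c d : leG a b -> leG c d -> leG (a + c) (b + d).
Proof.
move=> ab cd; apply: leG_trans (leGD2r _ ab) _.
by rewrite addrC [b + _]addrC; apply: leGD2r.
Qed.

Let leGMn a b k : leG a b -> leG (a *+ k) (b *+ k).
Proof. by move=> ab; elim: k => [|k ih]; rewrite ?mulr0n // !mulrS; apply: leGD. Qed.

Let leGN a b : leG a b -> leG (- b) (- a).
Proof.
move=> ab; have := leGD2r (- a - b) ab.
by rewrite addrA subrr add0r [- a - b]addrC addrA subrr add0r.
Qed.

(** If [q < p], a positive multiple of [u] would be at most 0; it also dominates [u], so [u] would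
    be 0. *)
Let leGz (p q : int) : leG (u *~ p) (u *~ q) -> p <= q.
Proof.
move=> pq; rewrite leNgt; apply/negP => qp; apply: u_neq0.
have : leG (u *~ (p - q)) 0 by rewrite mulrzBr -(subrr (u *~ q)); apply: leGD2r.
have : exists k : nat, p - q = k.+1%:Z by exists `|p - q|%N.-1; lia.
move=> [k ->]; rewrite -pmulrn mulrS => H; apply: leG_anti => //.
apply: leG_trans H; rewrite -[X in leG X _]addr0; apply: leGD => //.
by have := leGMn k u_ge0; rewrite mul0rn.
Qed.

(** The lower Dedekind cut of the ratio of [g] to [u]. Denominators have the form [q.+1], so that
    they are positive without a side condition. *)
Let cut (g : G) : set R :=
  [set x | exists p : int, exists q : nat,
     x = p%:~R / q.+1%:R /\ leG (u *~ p) (g *+ q.+1)].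

Let emb g := sup (cut g).

Let pos q : 0 < (q.+1%:R : R). Proof. by rewrite ltr0n. Qed.

Let cut_le g p q x :
  leG (g *+ q.+1) (u *~ p) -> cut g x -> x <= p%:~R / q.+1%:R.
Proof.
move=> gp [p' [q' [-> pg]]].
rewrite ler_pdivrMr // mulrAC ler_pdivlMr // -!(intrM _ _ (Posz _)) ler_int.
apply: leGz; rewrite !mulrzA -!pmulrn; apply: leG_trans (leGMn q.+1 pg) _.
by rewrite -mulrnA mulnC mulrnA; apply: leGMn.
Qed.

Let has_sup_cut g : has_sup (cut g).
Proof.
have [k gk] := arch g u_ge0 u_neq0; have [l gl] := arch (- g) u_ge0 u_neq0.
split.
  exists ((- l%:Z)%:~R / 1%:R), (- l%:Z), 0%N; split => //.
  by rewrite mulrNz -pmulrn mulr1n -[g]opprK; apply: leGN.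
by exists (k%:Z%:~R / 1%:R) => x; apply: cut_le; rewrite -pmulrn mulr1n.
Qed.

Let emb_ub g p q : leG (g *+ q.+1) (u *~ p) -> emb g <= p%:~R / q.+1%:R.
Proof. by move=> gp; apply: (ge_sup (has_sup_cut g).1) => x; apply: cut_le. Qed.

Let emb_lb g p q : leG (u *~ p) (g *+ q.+1) -> p%:~R / q.+1%:R <= emb g.
Proof. by move=> gp; apply: (sup_upper_bound (has_sup_cut g)); exists p, q. Qed.

(** The fractions above [g] come arbitrarily close to the supremum of those below: by totality, a
    rational just above [emb g] is on one side of [g], and on the lower side it would be at most
    [emb g]. *)
Let emb_approx g e : 0 < e -> exists p q,
  leG (g *+ q.+1) (u *~ p) /\ p%:~R / q.+1%:R < emb g + e.
Proof.
move=> e_gt0; have /rat_in_itvoo[r] : emb g < emb g + e by rewrite ltrDl.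
rewrite in_itv /= => /andP[r_gt r_lt]; exists (numq r), `|denq r|%N.-1.
have dr : (`|denq r|%N.-1).+1 = `|denq r|%N by rewrite prednK // absz_gt0 denq_neq0.
have rE : ratr r = (numq r)%:~R / (`|denq r|%N.-1).+1%:R :> R.
  by rewrite dr /ratr pmulrn gez0_abs // denq_ge0.
rewrite rE in r_gt r_lt; split=> //.
have [//|/emb_lb] := leG_total (g *+ (`|denq r|%N.-1).+1) (u *~ numq r).
by move=> /(lt_le_trans r_gt); rewrite ltxx.
Qed.

Let emb_subadd g h : emb (g + h) <= emb g + emb h.
Proof.
(* Approximating [g] and [h] from above, each within half of the supposed gap, and adding the two
   fractions gives too small an upper bound for [g + h]. *)
rewrite leNgt; apply/negP => lt_gh.
pose e := (emb (g + h) - (emb g + emb h)) / 2.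
have e_gt0 : 0 < e by rewrite divr_gt0 // subr_gt0.
have [p [q [gp pq]]] := emb_approx g e_gt0.
have [p' [q' [hp pq']]] := emb_approx h e_gt0.
have: emb (g + h) <= (p * q'.+1 + p' * q.+1)%:~R / (q.+1 * q'.+1).-1.+1%:R.
  apply: emb_ub; rewrite prednK ?muln_gt0 // mulrnDl mulrzDr !mulrzA -!pmulrn.
  by apply: leGD; [|rewrite mulnC]; rewrite mulrnA; apply: leGMn.
rewrite prednK ?muln_gt0 //.
have -> : (p * q'.+1 + p' * q.+1)%:~R / (q.+1 * q'.+1)%:R
   = p%:~R / q.+1%:R + p'%:~R / q'.+1%:R :> R.
  by rewrite addf_div ?pnatr_eq0 // intrD !intrM natrM.
move=> /le_lt_trans/(_ (ltrD pq pq')); rewrite addrACA -splitr /=.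
by rewrite addrC subrK ltxx.
Qed.

Let emb_ge0 g : leG 0 g -> 0 <= emb g.
Proof.
by move=> g0; have := @emb_lb g 0 0%N; rewrite mul0r; apply; rewrite mulr0z mulr1n.
Qed.

Let emb0 : emb 0 = 0.
Proof.
apply/le_anti; rewrite emb_ge0 // andbT.
by have := @emb_ub 0 0 0%N; rewrite mul0r; apply; rewrite mulr0z mul0rn.
Qed.

Let embN g : emb (- g) = - emb g.
Proof.
apply: le_anti; rewrite -[_ <= emb (- g)]subr_ge0 opprK.
have -> : 0 <= emb (- g) + emb g.
  by rewrite -emb0 -(addNr g); apply: emb_subadd.
rewrite andbT lerNr; apply: (ge_sup (has_sup_cut g).1) => x [p [q [-> pg]]].
rewrite lerNr -mulNr -mulrNz; apply: emb_ub.
by rewrite mulNrn mulrNz; apply: leGN.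
Qed.

Lemma hoelder_embedding : exists e : G -> R,
  [/\ forall a b, e (a + b) = e a + e b, forall a b, leG a b <-> e a <= e b & e u = 1].
Proof.
exists emb; have embD a b : emb (a + b) = emb a + emb b.
  apply: le_anti; rewrite emb_subadd /=.
  by have := emb_subadd (a + b) (- b); rewrite addrK embN lerBrDr.
split=> // [a b|]; first split.
- move=> /(leGD2r (- a)); rewrite subrr => /emb_ge0.
  by rewrite embD embN subr_ge0.
- move=> ab; have [//|ba] := leG_total a b.
  have [->//|/eqP neq] := eqVneq a b.
  have: leG 0 (a - b) by rewrite -(subrr b); apply: leGD2r.
  have ab0 : a - b <> 0 by move/subr0_eq.
  (* Strictness uses the archimedean property: some multiple of [a - b] exceeds [u], so
     [emb (a - b)] is at least the inverse of a positive integer. *)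
  move=> /arch/(_ ab0)-/(_ u)[[|k] uk].
    by case: u_neq0; apply: leG_anti => //; rewrite mulr0n in uk.
  have := @emb_lb (a - b) 1 k; rewrite mulr1z => /(_ uk).
  rewrite embD embN => lb.
  have k_pos : (0 : R) < 1%:~R / k.+1%:R by rewrite divr_gt0.
  by have := lt_le_trans k_pos lb; rewrite subr_gt0 ltNge ab.
- apply: le_anti.
  have := @emb_lb u 1 0%N; have := @emb_ub u 1 0%N.
  by rewrite !mulr1z mulr1n divr1 => -> // ->.
Qed.

End Hoelder.

(** * The ghost group of a nu-semifield *)

Section Ghosts.
Variable F : nuSemifield.

Definition ghosts := {g : F | ghost g}.
HB.instance Definition _ := gen_eqMixin ghosts.
HB.instance Definition _ := gen_choiceMixin ghosts.

Implicit Types g h k : ghosts.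

Lemma ghosts_eq g h : sval g = sval h -> g = h.
Proof. by case: g h => [g gP] [h hP] /= gh; apply: eq_exist. Qed.

Definition nug (a : F) : ghosts := exist _ (nu a) (nu_ghost a).

(** The ghosts are written additively: the product of [F] becomes the group law, and the sum of [F]
    becomes the join. *)
Definition gadd g h : ghosts := exist _ (smul (sval g) (sval h)) (ghostMl (sval g) (proj2_sig h)).

Definition gjoin g h : ghosts := exist _ (sadd (sval g) (sval h)) (ghostD (proj2_sig g) (proj2_sig h)).

Lemma nug_onto g : exists2 a, tangible a & nug a = g.
Proof. by have [a aT ag] := nu_onto (proj2_sig g); exists a => //; apply: ghosts_eq. Qed.

Lemma nugM (a b : F) : nug (smul a b) = gadd (nug a) (nug b).
Proof. by apply: ghosts_eq; apply: nuM. Qed.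

Lemma nugD (a b : F) : nug (sadd a b) = gjoin (nug a) (nug b).
Proof. by apply: ghosts_eq; apply: nuD. Qed.

Lemma gaddA : associative gadd.
Proof. by move=> g h k; apply: ghosts_eq; apply: smulA. Qed.

(** Commutativity and inverses are assumed for tangible elements only; they pass to ghosts because
    [nu] maps the tangible elements onto them. *)
Lemma gaddC : commutative gadd.
Proof.
move=> g h; have [a aT <-] := nug_onto g; have [b bT <-] := nug_onto h.
by rewrite -!nugM tangibleC.
Qed.

Lemma gadd0 : left_id (nug sone) gadd.
Proof. by move=> g; have [a aT <-] := nug_onto g; rewrite -nugM smul1l. Qed.

Lemma gopp_exists g : exists h, gadd h g = nug sone.
Proof.
have [a aT <-] := nug_onto g; have [b bT ab] := tangibleV aT.
by exists (nug b); rewrite gaddC -nugM ab.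
Qed.

Definition gopp g := projT1 (cid (gopp_exists g)).

Lemma gaddN : left_inverse (nug sone) gopp gadd.
Proof. by move=> g; rewrite /gopp; case: cid. Qed.

HB.instance Definition _ := GRing.isZmodule.Build ghosts gaddA gaddC gadd0 gaddN.

Definition gleq g h := gle (sval g) (sval h).

Lemma gjoinC g h : gjoin g h = gjoin h g.
Proof. by apply: ghosts_eq; apply: saddC. Qed.

Lemma gjoinA g h k : gjoin g (gjoin h k) = gjoin (gjoin g h) k.
Proof. by apply: ghosts_eq; apply: saddA. Qed.

Lemma gjoinDr g h k : gjoin g h + k = gjoin (g + k) (h + k).
Proof. by apply: ghosts_eq; apply: smulDl. Qed.

Lemma nu_id g : nu (sval g) = sval g.
Proof. by have [a aT <-] := nug_onto g; apply: nu_idem. Qed.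

Lemma gleqP g h : gleq h g <-> gjoin g h = g.
Proof.
split=> [hg|gh]; last by apply: gle_add (proj2_sig g) (proj2_sig h) (congr1 sval gh).
apply: ghosts_eq => /=; have [gh|gh] := pselect (sval g = sval h).
  by rewrite -gh nu_eq_add // nu_id.
by rewrite nu_gt_add // !nu_id.
Qed.

Lemma gleq_anti g h : gleq g h -> gleq h g -> g = h.
Proof. by move=> /gleqP gh /gleqP hg; rewrite -hg gjoinC. Qed.

Lemma gleq_trans g h k : gleq g h -> gleq h k -> gleq g k.
Proof. by apply: gle_trans; apply: proj2_sig. Qed.

Lemma gleqD2r g h k : gleq g h -> gleq (g + k) (h + k).
Proof. by move=> /gleqP gh; apply/gleqP; rewrite -gjoinDr gh. Qed.

Lemma gleq_refl g : gleq g g.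
Proof. exact: gle_refl (proj2_sig g). Qed.

Lemma gleq_joinl g h : gleq g (gjoin g h).
Proof. by apply/gleqP; rewrite gjoinC gjoinA (gleqP g g).1 //; apply: gleq_refl. Qed.

Lemma gjoin_lub g h k : gleq g k -> gleq h k -> gleq (gjoin g h) k.
Proof. by move=> /gleqP gk /gleqP hk; apply/gleqP; rewrite gjoinA gk. Qed.

Lemma nug_spow (a : F) (n : nat) : nug (spow a n) = nug a *+ n.
Proof. by elim: n => [|n ih]; rewrite ?mulr0n // mulrS -ih; apply: nugM. Qed.

Hypothesis Farch : nu_archimedean F.

Lemma gleq_arch g h : gleq 0 g -> g <> 0 -> exists n, gleq h (g *+ n).
Proof.
have [a aT <-] := nug_onto g; have [b bT <-] := nug_onto h => a0 an0.
have [|n [nP _]] := @Farch a b; last by exists n; rewrite -nug_spow.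
by split=> // /esym a1; apply: an0; apply: ghosts_eq.
Qed.

(* For [p = c^+] and [q = c^-], which are disjoint, no multiple of [p]
   dominates [q]; hence one of the two is trivial. *)
Lemma gleq_total g h : gleq g h \/ gleq h g.
Proof.
suff tot0 c : gleq c 0 \/ gleq 0 c.
  have [/(gleqD2r h)|/(gleqD2r h)] := tot0 (g - h); rewrite subrK add0r; tauto.
have [|nc] := pselect (gleq c 0); [by left|right].
pose p := gjoin c 0; pose q := p - c.
have p_ge0 : gleq 0 p by rewrite /p gjoinC; apply: gleq_joinl.
have cp : gleq c p by apply: gleq_joinl.
have p_neq0 : p <> 0 by move=> p0; apply: nc; rewrite -p0.
have [k qkp] := gleq_arch q p_ge0 p_neq0.
have disj z : gleq (- p) z -> gleq (- q) z -> gleq 0 z.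
  move=> pz qz; have -> : 0 = gjoin (- q) (- p); last exact: gjoin_lub.
  by rewrite /q opprB; have := gjoinDr c 0 (- p); rewrite add0r subrr.
(* Disjointness from [q] passes from [p] to its multiples: the induction hypothesis for [z + p]
   gives that [z] is at least [- p], and [disj] concludes. *)
have disjn j : forall z, gleq (- (p *+ j)) z -> gleq (- q) z -> gleq 0 z.
  elim: j => [|j ih] z; first by rewrite mulr0n oppr0.
  move=> pz qz; apply: disj => //.
  have := gleqD2r p pz; rewrite mulrSr opprD addrNK => pz'.
  have /(gleqD2r (- p)) : gleq 0 (z + p).
    apply: ih => //; apply: gleq_trans qz _.
    by have := gleqD2r z p_ge0; rewrite add0r addrC.
  by rewrite add0r addrK.
have : gleq 0 (- q).
  apply: (disjn k); last exact: gleq_refl.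
  have := gleqD2r (- q - p *+ k) qkp.
  by rewrite addrA subrr add0r [- q - _]addrC addrA subrr add0r.
move=> /(gleqD2r p); rewrite add0r /q opprB addrNK => pc.
exact: gleq_trans p_ge0 pc.
Qed.

End Ghosts.

(** * Real logarithms on a nu-semifield *)

Record logarithm (R : realType) (F : nuSemifield) := Logarithm {
  log :> F -> R;
  logM : forall a b, log (smul a b) = log a + log b;
  logD : forall a b, log (sadd a b) = Num.max (log a) (log b);
  log_inj : forall a b, nu_eq a b <-> log a = log b;
  log_ratr : forall a (q : rat), exists2 b, tangible b & log b = ratr q * log a
}.

(** Hoelder's theorem needs a positive element, hence the separate case where all of [F] is 1 up to
    [nu]. Rational multiples come from divisibility: take a root for the denominator, then a power
    for the numerator. *)
Lemma logarithm_exists (R : realType) (F : nuSemifield) :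
  nu_divisible F -> nu_archimedean F ->
  (forall a b : F, nu_eq a b) \/
  exists (log : logarithm R F) (u : F), tangible u /\ log u = 1.
Proof.
move=> Fdiv Farch.
have [triv|/existsNP[a0 /eqP]] := pselect (forall g : ghosts F, g = 0).
  by left=> a b; have := triv (nug b); rewrite -(triv (nug a)) => /(congr1 sval).
move=> a0_neq0; right.
have [u [u_ge0 /eqP u_neq0]] : exists u : ghosts F, gleq 0 u /\ u != 0.
  have [a0le|a0ge] := gleq_total Farch a0 0; last by exists a0.
  exists (- a0); rewrite oppr_eq0; split=> //.
  by have := gleqD2r (- a0) a0le; rewrite subrr add0r.
have [e [eD e_le eu]] := hoelder_embedding R (@gleq_anti F) (@gleq_trans F)
  (gleq_total Farch) (@gleqD2r F) u_ge0 u_neq0 (gleq_arch Farch).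
have e_inj g h : e g = e h -> g = h.
  by move=> gh; apply: gleq_anti; apply/e_le; rewrite gh.
have e0 : e 0 = 0 by have := eD 0 0; rewrite addr0 -[LHS]addr0 => /addrI.
have eMn g k : e (g *+ k) = e g *+ k.
  by elim: k => [|k ih]; rewrite ?mulr0n // !mulrS eD ih.
have eN g : e (- g) = - e g.
  by apply/eqP; rewrite -addr_eq0 -eD addNr e0.
have logM a b : e (nug (smul a b)) = e (nug a) + e (nug b) by rewrite nugM eD.
have logD a b : e (nug (sadd a b)) = Num.max (e (nug a)) (e (nug b)).
  rewrite nugD; have [ab|/ltW ba] := leP (e (nug a)) (e (nug b)).
    by rewrite gjoinC; congr e; apply/gleqP/e_le.
  by congr e; apply/gleqP/e_le.
have log_inj a b : nu_eq a b <-> e (nug a) = e (nug b).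
  split=> [ab|/e_inj/(congr1 sval)//]; congr e; exact: ghosts_eq.
have log_ratr a (q : rat) : exists2 b : F, tangible b & e (nug b) = ratr q * e (nug a).
  have dq_gt0 : (0 < `|denq q|)%N by rewrite absz_gt0 denq_neq0.
  have [d da] := Fdiv a _ dq_gt0.
  have {}da : e (nug d) *+ `|denq q|%N = e (nug a).
    by rewrite -eMn -nug_spow; apply/log_inj.
  have [b bT bE] := nug_onto (nug d *~ numq q).
  exists b => //; rewrite bE -da.
  have -> : e (nug d *~ numq q) = e (nug d) *~ numq q.
    by case: (numq q) => m; rewrite ?NegzE ?mulrNz ?eN -pmulrn eMn.
  rewrite /ratr -mulr_natl mulrA -mulrzl; congr (_ * _).
  rewrite pmulrn gez0_abs ?denq_ge0 // divfK // intr_eq0 denq_neq0 //.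
have [u' u'T u'E] := nug_onto u.
by exists (Logarithm logM logD log_inj log_ratr), u'; rewrite /= u'E.
Qed.

(** A classical equality test on formal fractions, so that finite families of generators can be
    sequences with a membership predicate. *)
HB.instance Definition _ (F : nuSemifield) (n : nat) := gen_eqMixin (fraction F n).

(** * Kernels as convex subgroups *)

Section LatticeArithmetic.
Variable R : realType.
Implicit Types a b : R.

Lemma max_cases a b : Num.max a b = a /\ b <= a \/ Num.max a b = b /\ a <= b.
Proof. by have [?|/ltW ?] := leP a b; [right|left]. Qed.

Lemma min_cases a b : Num.min a b = a /\ a <= b \/ Num.min a b = b /\ b <= a.
Proof. by have [?|/ltW ?] := leP a b; [left|right]. Qed.

Lemma abs_cases a : `|a| = a /\ 0 <= a \/ `|a| = - a /\ a <= 0.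
Proof. by have [?|/ltW ?] := ger0P a; [left|right]. Qed.

End LatticeArithmetic.

Ltac lattice_lra :=
  repeat match goal with
  | |- context [Num.max ?a ?b] => case: (max_cases a b) => -[->]
  | |- context [Num.min ?a ?b] => case: (min_cases a b) => -[->]
  | |- context [Num.norm ?a] => case: (abs_cases a) => -[->]
  end; intros; lra.

Lemma truncation (R : realType) (f p q : R) : 0 <= p -> 0 <= q -> `|f| <= p + q ->
  let a := Num.max (Num.min f p) (- p) in `|a| <= p /\ `|f - a| <= q.
Proof. by move=> p0 q0 /=; rewrite ler_norml => /andP[]; split; move: p0 q0; lattice_lra. Qed.

Section LogarithmicValues.
Variables (R : realType) (F : nuSemifield) (log : logarithm R F) (n : nat).

Local Notation S := (FLambda F n).
Implicit Types (f g h : S) (x y : point F n) (K A : set S) (s : seq S).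

Lemma log1 : log sone = 0.
Proof. by have := logM log sone sone; rewrite smul1l -[LHS]addr0 => /addrI. Qed.

Definition seqset s : set S := [set f | f \in s].

Definition coords x : 'rV[R]_n := \row_i log (x i).

(** The logarithm of the quotient, taken as a difference of reals: a ghost value of the denominator
    need not be invertible in [F]. *)
Definition fval f x : R := log (peval (fnum f) x) - log (peval (fden f) x).

Lemma log_spow (a : F) k : log (spow a k) = k%:R * log a.
Proof.
elim: k => [|k ih]; first by rewrite mul0r log1.
by rewrite [spow a k.+1]/(smul a (spow a k)) logM ih -add1n natrD mulrDl mul1r.
Qed.

Lemma log_meval (m : monomial F n) x :
  log (meval m x) = log (sval (mcoef m)) + \sum_i (mexp m i)%:R * log (x i).
Proof.
rewrite /meval logM (big_morph (log : F -> R) (logM log) log1); congr (_ + _).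
by apply: eq_bigr => i _; rewrite log_spow.
Qed.

Lemma log_mmul (m m' : monomial F n) x :
  log (meval (mmul m m') x) = log (meval m x) + log (meval m' x).
Proof.
rewrite !log_meval /= logM addrACA -big_split /=; congr (_ + _).
by apply: eq_bigr => i _; rewrite ffunE natrD mulrDl.
Qed.

Lemma log_pmul (p q : polynomial F n) x :
  log (peval (pmul p q) x) = log (peval p x) + log (peval q x).
Proof.
have log_pmulm m : log (peval (pmulm m q) x) = log (meval m x) + log (peval q x).
  by elim: q => [m'|q1 ih1 q2 ih2] /=; rewrite ?log_mmul // !logD ih1 ih2 addr_maxr.
by elim: p => [m|p1 ih1 p2 ih2] /=; rewrite ?log_pmulm // !logD ih1 ih2 addr_maxl.
Qed.

Lemma fval_eqv f g : eqv f g <-> forall x, fval f x = fval g x.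
Proof.
split=> fg x; last first.
  apply/(log_inj log); rewrite !logM; move: (fg x); rewrite /fval => /eqP.
  by rewrite subr_eq addrAC eq_sym subr_eq eq_sym => /eqP.
move/(_ x)/(log_inj log): fg; rewrite !logM /fval => /eqP fg; apply/eqP.
by rewrite subr_eq addrAC eq_sym subr_eq eq_sym.
Qed.

Lemma fvalM f g x : fval (fmul f g) x = fval f x + fval g x.
Proof. by rewrite /fval /= !log_pmul opprD addrACA. Qed.

Lemma fvalV f x : fval (finv f) x = - fval f x.
Proof. by rewrite /fval /= opprB. Qed.

Lemma fvalD f g x : fval (fadd f g) x = Num.max (fval f x) (fval g x).
Proof.
rewrite /fval /= logD !log_pmul addr_maxl; congr Num.max; first by lra.
by rewrite opprD [X in _ + X]addrC addrACA subrr addr0.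
Qed.

Lemma log_mconst (c : tang F) x : log (meval (mconst n c) x) = log (sval c).
Proof. by rewrite log_meval big1 ?addr0 // => i _; rewrite ffunE mul0r. Qed.

Lemma fval_fconst c x : fval (fconst n c) x = log (sval c).
Proof. by rewrite /fval /= !log_mconst log1 subr0. Qed.

Lemma fval1 x : fval fone x = 0.
Proof. by rewrite fval_fconst log1. Qed.

Definition fabs f : S := fadd f (finv f).

Lemma fval_fabs f x : fval (fabs f) x = `|fval f x|.
Proof. by rewrite fvalD fvalV maxrN. Qed.

Definition fmin f g : S := finv (fadd (finv f) (finv g)).

Lemma fval_fmin f g x : fval (fmin f g) x = Num.min (fval f x) (fval g x).
Proof. by rewrite fvalV fvalD !fvalV oppr_max !opprK. Qed.

Definition fnorm s : S := foldr (fun g h => fmul (fabs g) h) fone s.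

Lemma fval_fnorm s x : fval (fnorm s) x = \sum_(g <- s) `|fval g x|.
Proof.
elim: s => [|g s ih] /=; first by rewrite big_nil fval1.
by rewrite fvalM fval_fabs big_cons ih.
Qed.

Definition fexp f k : S := iter k (fmul f) fone.

Lemma fval_fexp f k x : fval (fexp f k) x = k%:R * fval f x.
Proof.
elim: k => [|k ih]; first by rewrite mul0r fval1.
by rewrite [fexp f k.+1]/(fmul f (fexp f k)) fvalM ih -add1n natrD mulrDl mul1r.
Qed.

Lemma log_tangible (a : F) : exists c : tang F, log (sval c) = log a.
Proof.
have [c cT] := log_ratr log a 1; rewrite rmorph1 mul1r => cE.
by exists (exist _ c cT).
Qed.

Lemma log_opp (a : F) : exists b : F, log b = - log a.
Proof.
have [b _] := log_ratr log a (-1); have -> : ratr (-1) = -1 :> R by rewrite rmorphN1.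
by rewrite mulN1r; exists b.
Qed.

Lemma fval_tangible f x : exists c : tang F, log (sval c) = fval f x.
Proof.
have [b bE] := log_opp (peval (fden f) x).
have [c cE] := log_tangible (smul (peval (fnum f) x) b).
by exists c; rewrite cE logM bE.
Qed.

Lemma ker_val K f g : is_kernel K -> (forall x, fval f x = fval g x) -> K f -> K g.
Proof. by move=> KK fg Kf; apply: (ker_eqv KK _ Kf); apply/fval_eqv. Qed.

Lemma ker_exp K f k : is_kernel K -> K f -> K (fexp f k).
Proof. by move=> KK Kf; elim: k => [|k ih]; [apply: ker1|apply: kerM]. Qed.

(** Convexity with both weights equal to 1, applied to [f] and its inverse. *)
Lemma ker_abs K f : is_kernel K -> K f -> K (fabs f).
Proof.
move=> KK Kf; have /(ker_conv KK Kf (kerV KK Kf)) : eqv (fadd (fone : S) fone) fone.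
  by apply/fval_eqv => x; rewrite fvalD fval1 maxxx.
by apply: ker_val => // x; rewrite !fvalD !fvalM fval1 !add0r.
Qed.

Lemma ker_norm K s : is_kernel K -> (forall g, g \in s -> K g) -> K (fnorm s).
Proof.
move=> KK; elim: s => [|g s ih] sK /=; first exact: (ker1 KK).
apply: (kerM KK); first by apply: ker_abs => //; apply: sK; rewrite mem_head.
by apply: ih => h hs; apply: sK; rewrite in_cons hs orbT.
Qed.

(** With [u = f / g], the bound by [g] says that [u + 1] is 1, and then [u g + 1] is [f + 1], which
    is [f] because [f] is nonnegative. *)
Lemma ker_between K f g : is_kernel K -> K g ->
  (forall x, 0 <= fval f x <= fval g x) -> K f.
Proof.
move=> KK Kg fg; pose u : S := fmul f (finv g).
have /(ker_conv KK Kg (ker1 KK)) : eqv (fadd u fone) fone.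
  by apply/fval_eqv => x; rewrite fvalD fvalM fvalV fval1; have := fg x; lattice_lra.
by apply: ker_val => // x; rewrite fvalD !fvalM fvalV !fval1; have := fg x; lattice_lra.
Qed.

(** The positive and negative parts of [f] both lie between 0 and the absolute value of [g], and [f]
    is their quotient. *)
Lemma ker_dominated K f g : is_kernel K -> K g ->
  (forall x, `|fval f x| <= `|fval g x|) -> K f.
Proof.
move=> KK /(ker_abs KK) Kg fg.
have Kp : K (fadd f fone).
  apply: (ker_between KK Kg) => x; rewrite fvalD fval1 fval_fabs; have := fg x; lattice_lra.
have Kn : K (fadd (finv f) fone).
  apply: (ker_between KK Kg) => x; rewrite fvalD fvalV fval1 fval_fabs; have := fg x; lattice_lra.
apply: ker_val (kerM KK Kp (kerV KK Kn)) => // x.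
by rewrite fvalM fvalV !fvalD fvalV !fval1; lattice_lra.
Qed.

(** The common form of all kernels below: [p] is a sum of absolute values for a finitely generated
    kernel, the constant 1 for [kerF], and a sum of absolute linear forms for a flat. *)
Definition dominated (p : point F n -> R) : set S :=
  [set f | exists k : nat, forall x, `|fval f x| <= k%:R * p x].

Lemma ker_dominated_norm K f s k : is_kernel K -> (forall g, g \in s -> K g) ->
  (forall x, `|fval f x| <= k%:R * \sum_(g <- s) `|fval g x|) -> K f.
Proof.
move=> KK sK fs; apply: (ker_dominated KK (ker_exp k KK (ker_norm KK sK))) => x.
rewrite fval_fexp fval_fnorm; apply: le_trans (fs x) (ler_norm _).
Qed.

Lemma convex_combination_norm (u v a b : R) : Num.max u v = 0 ->
  `|Num.max (u + a) (v + b)| <= `|a| + `|b|.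
Proof. by lattice_lra. Qed.

Lemma kgen_kernel A : is_kernel (kgen A).
Proof.
split.
- by move=> f g fg Af K KK AK; apply: ker_eqv fg (Af K KK AK).
- by move=> K KK _; apply: ker1.
- by move=> f g Af Ag K KK AK; apply: kerM (Af K KK AK) (Ag K KK AK).
- by move=> f Af K KK AK; apply: kerV (Af K KK AK).
- by move=> f g u v Af Ag uv K KK AK; apply: ker_conv (Af K KK AK) (Ag K KK AK) uv.
Qed.

Lemma sub_kgen A : A `<=` kgen A.
Proof. by move=> f Af K _; apply. Qed.

Lemma kgen_sub A K : is_kernel K -> A `<=` K -> kgen A `<=` K.
Proof. by move=> KK AK f; apply. Qed.

Lemma dominated_kernel p : (forall x, 0 <= p x) -> is_kernel (dominated p).
Proof.
move=> p_ge0; split.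
- by move=> f g /fval_eqv fg [k fk]; exists k => x; rewrite -fg.
- by exists 0%N => x; rewrite fval1 normr0 mul0r.
- move=> f g [k fk] [l gl]; exists (k + l)%N => x.
  by rewrite fvalM natrD mulrDl (le_trans (ler_normD _ _)) // lerD.
- by move=> f [k fk]; exists k => x; rewrite fvalV normrN.
- move=> f g u v [k fk] [l gl] /fval_eqv uv; exists (k + l)%N => x.
  have := uv x; rewrite !fvalD !fvalM fval1 natrD mulrDl => uvx.
  by apply: le_trans (convex_combination_norm _ _ uvx) _; rewrite lerD.
Qed.

Definition norm_sum s x : R := \sum_(g <- s) `|fval g x|.

Lemma norm_sum_ge0 s x : 0 <= norm_sum s x.
Proof. by apply: sumr_ge0. Qed.

Lemma kgen_seq s : kgen (seqset s) = dominated (norm_sum s).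
Proof.
apply/seteqP; split=> [|f [k fk]].
  apply: kgen_sub => [|f /= fs]; first by apply: dominated_kernel; apply: norm_sum_ge0.
  exists 1%N => x; rewrite mul1r /norm_sum (big_rem f fs) /= lerDl.
  by apply: sumr_ge0.
apply: (ker_dominated_norm (kgen_kernel _) _ fk) => g gs.
exact: sub_kgen.
Qed.

Lemma kgen1 f : kgen [set f] = dominated (fun x => `|fval f x|).
Proof.
have -> : [set f] = seqset [:: f].
  by apply/seteqP; split=> g; rewrite /seqset /= mem_seq1 => /eqP.
rewrite kgen_seq; congr dominated; apply/funext => x.
by rewrite /norm_sum big_seq1.
Qed.

(** Generation is finitary: the elements generated by finite lists from [A] form a kernel, since the
    lists of two elements can be concatenated. *)
Lemma kgenP A f :
  kgen A f <-> exists s, (forall g, g \in s -> A g) /\ kgen (seqset s) f.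
Proof.
split=> [|[s [sA]]]; last first.
  by apply: (kgen_sub (kgen_kernel A)) => g /sA; apply: sub_kgen.
move=> Af; pose K := [set f : S | exists s, (forall g, g \in s -> A g) /\ kgen (seqset s) f].
have mono s t g : (forall h, h \in s -> h \in t) -> kgen (seqset s) g -> kgen (seqset t) g.
  by move=> st; apply: (kgen_sub (kgen_kernel _)) => h /st; apply: sub_kgen.
have catA s t : (forall g, g \in s -> A g) -> (forall g, g \in t -> A g) ->
    forall g, g \in s ++ t -> A g.
  by move=> sA tA g; rewrite mem_cat => /orP[/sA|/tA].
have catl s t g : kgen (seqset s) g -> kgen (seqset (s ++ t)) g.
  by apply: mono => h hs; rewrite mem_cat hs.
have catr s t g : kgen (seqset t) g -> kgen (seqset (s ++ t)) g.
  by apply: mono => h hs; rewrite mem_cat hs orbT.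
suff KK : is_kernel K.
  apply: (Af K KK) => g Ag; exists [:: g]; split.
    by move=> h; rewrite inE => /eqP ->.
  by apply: sub_kgen; rewrite /seqset /= mem_seq1.
split.
- move=> g h gh [s [sA sg]]; exists s; split=> //.
  by apply: (ker_eqv (kgen_kernel (seqset s)) gh).
- by exists [::]; split=> //; exact: (ker1 (kgen_kernel _)).
- move=> g h [s [sA sg]] [t [tA th]]; exists (s ++ t); split; first exact: catA.
  by apply: (kerM (kgen_kernel _)); [apply: catl|apply: catr].
- move=> g [s [sA sg]]; exists s; split=> //.
  exact: (kerV (kgen_kernel _)).
- move=> g h v w [s [sA sg]] [t [tA th]] vw; exists (s ++ t); split; first exact: catA.
  by apply: (ker_conv (kgen_kernel _)) => //; [apply: catl|apply: catr].
Qed.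

(* Riesz decomposition: truncate f to the interval between -|g1| and |g1|. *)
Lemma kprodP K1 K2 f : is_kernel K1 -> is_kernel K2 ->
  kprod K1 K2 f <->
  exists g1 g2, [/\ K1 g1, K2 g2 & forall x, `|fval f x| <= `|fval g1 x| + `|fval g2 x|].
Proof.
move=> KK1 KK2; split=> [[a [b [Ka Kb /fval_eqv fab]]]|[g1 [g2 [Kg1 Kg2 fg]]]].
  by exists a, b; split=> // x; rewrite fab fvalM ler_normD.
pose a : S := fadd (fmin f (fabs g1)) (finv (fabs g1)).
have aE x : fval a x = Num.max (Num.min (fval f x) `|fval g1 x|) (- `|fval g1 x|).
  by rewrite fvalD fvalV fval_fmin fval_fabs.
exists a, (fmul f (finv a)); split.
- apply: ker_dominated Kg1 _ => // x; rewrite aE.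
  by have [] := truncation (normr_ge0 _) (normr_ge0 _) (fg x).
- apply: ker_dominated Kg2 _ => // x; rewrite fvalM fvalV aE.
  by have [] := truncation (normr_ge0 _) (normr_ge0 _) (fg x).
- by apply/fval_eqv => x; rewrite !fvalM fvalV addrC subrK.
Qed.

(** All closure properties but convexity hold factor by factor. A convex combination is instead
    bounded by a sum of two norms and decomposed anew by [kprodP]. *)
Lemma kprod_kernel K1 K2 : is_kernel K1 -> is_kernel K2 -> is_kernel (kprod K1 K2).
Proof.
move=> KK1 KK2; split.
- move=> f g /fval_eqv fg [a [b [Ka Kb /fval_eqv fab]]]; exists a, b; split=> //.
  by apply/fval_eqv => x; rewrite -fg.
- exists fone, fone; split; [exact: ker1|exact: ker1|].
  by apply/fval_eqv => x; rewrite fvalM fval1 addr0.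
- move=> f g [a [b [Ka Kb /fval_eqv fab]]] [a' [b' [Ka' Kb' /fval_eqv gab]]].
  exists (fmul a a'), (fmul b b'); split; [exact: kerM|exact: kerM|].
  by apply/fval_eqv => x; rewrite !fvalM fab gab !fvalM addrACA.
- move=> f [a [b [Ka Kb /fval_eqv fab]]]; exists (finv a), (finv b).
  split; [exact: kerV|exact: kerV|].
  by apply/fval_eqv => x; rewrite !(fvalM, fvalV) fab fvalM opprD.
- move=> f g u v /(kprodP _ KK1 KK2)[a [b [Ka Kb fab]]].
  move=> /(kprodP _ KK1 KK2)[a' [b' [Ka' Kb' gab]]] /fval_eqv uv.
  apply/kprodP => //; exists (fnorm [:: a; a']), (fnorm [:: b; b']); split.
  + by apply: ker_norm => // h; rewrite !inE => /orP[] /eqP ->.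
  + by apply: ker_norm => // h; rewrite !inE => /orP[] /eqP ->.
  + move=> x; have := uv x; rewrite fvalD fval1 => /convex_combination_norm.
    move=> /(_ (fval f x) (fval g x)); rewrite !fval_fnorm fvalD !fvalM => H.
    apply: le_trans H _; rewrite !big_cons !big_nil !addr0.
    rewrite [X in _ <= X + _]ger0_norm ?addr_ge0 // [X in _ <= _ + X]ger0_norm ?addr_ge0 //.
    rewrite addrACA.
    exact: lerD (fab x) (gab x).
Qed.

Lemma kprod_subl K1 K2 : is_kernel K1 -> is_kernel K2 -> K1 `<=` kprod K1 K2.
Proof.
move=> KK1 KK2 f K1f; exists f, fone; split; [exact: K1f|exact: ker1|].
by apply/fval_eqv => x; rewrite fvalM fval1 addr0.
Qed.

Lemma kprod_subr K1 K2 : is_kernel K1 -> is_kernel K2 -> K2 `<=` kprod K1 K2.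
Proof.
move=> KK1 KK2 f K2f; exists fone, f; split; [exact: ker1|exact: K2f|].
by apply/fval_eqv => x; rewrite fvalM fval1 add0r.
Qed.

Lemma kprod_sub K1 K2 K : is_kernel K -> K1 `<=` K -> K2 `<=` K -> kprod K1 K2 `<=` K.
Proof.
move=> KK K1K K2K f [a [b [/K1K Ka /K2K Kb /fval_eqv fab]]].
by apply: ker_val (kerM KK Ka Kb) => // x; rewrite fab.
Qed.

End LogarithmicValues.

Arguments ker_dominated [R F] log [n K f g].

(** * Rational linear forms *)

Section LinearForms.
Variables (R : realType) (n : nat).
Implicit Types (a v w : 'rV[rat]_n) (y z : 'rV[R]_n) (W : {vspace 'rV[rat]_n}).

(** Slopes are rational, while the coordinates of points are real logarithms. *)
Definition lin a y : R := \sum_i ratr (a 0 i) * y 0 i.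

Lemma lin0r a : lin a 0 = 0.
Proof. by rewrite /lin big1 // => i _; rewrite mxE mulr0. Qed.

Lemma linDr a y z : lin a (y + z) = lin a y + lin a z.
Proof. by rewrite /lin -big_split; apply: eq_bigr => i _; rewrite mxE mulrDr. Qed.

Lemma linZr a c y : lin a (c *: y) = c * lin a y.
Proof. by rewrite /lin mulr_sumr; apply: eq_bigr => i _; rewrite mxE mulrCA. Qed.

Lemma linBr a y z : lin a (y - z) = lin a y - lin a z.
Proof. by rewrite linDr -scaleN1r linZr mulN1r. Qed.

Lemma lin0l y : lin 0 y = 0.
Proof. by rewrite /lin big1 // => i _; rewrite mxE rmorph0 mul0r. Qed.

Lemma linDl a b y : lin (a + b) y = lin a y + lin b y.
Proof. by rewrite /lin -big_split; apply: eq_bigr => i _; rewrite mxE rmorphD mulrDl. Qed.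

Lemma linZl c a y : lin (c *: a) y = ratr c * lin a y.
Proof. by rewrite /lin mulr_sumr; apply: eq_bigr => i _; rewrite mxE rmorphM mulrA. Qed.

Lemma linBl a b y : lin (a - b) y = lin a y - lin b y.
Proof. by rewrite linDl -scaleN1r linZl rmorphN1 mulN1r. Qed.

Lemma lin_suml (I : finType) (c : I -> rat) (a : I -> 'rV[rat]_n) y :
  lin (\sum_i c i *: a i) y = \sum_i ratr (c i) * lin (a i) y.
Proof.
rewrite (big_morph (lin^~ y) (fun a b => linDl a b y) (lin0l y)).
by apply: eq_bigr => i _; rewrite linZl.
Qed.

Definition rat_vec v : 'rV[R]_n := map_mx ratr v.

Lemma lin_rat a v : lin a (rat_vec v) = ratr (\sum_i a 0 i * v 0 i).
Proof. by rewrite rmorph_sum; apply: eq_bigr => i _; rewrite mxE rmorphM. Qed.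

(** Some column of the cokernel of a basis matrix of [W] does not kill [a]; rescale it. The vector
    is rational, so points of [F] can be translated along it. *)
Lemma separating_vector W a : a \notin W ->
  exists v, (forall w, w \in W -> lin w (rat_vec v) = 0) /\ lin a (rat_vec v) = 1.
Proof.
move=> aW; pose M := \matrix_(i < \dim W) (vbasis W)`_i.
have inM w : w \in W -> (w <= M)%MS.
  move=> /coord_vbasis ->; apply: summx_sub => i _; apply: scalemx_sub.
  by rewrite -[X in (X <= _)%MS](rowK (fun i : 'I_(\dim W) => (vbasis W)`_i)) row_sub.
have : ~~ (a <= M)%MS.
  apply: contra aW => /submxP[D ->]; rewrite mulmx_sum_row; apply: memv_suml => i _.
  by rewrite memvZ // rowK vbasis_mem // mem_nth // size_tuple.
rewrite submxE => aM; have [j bj] : exists j, (a *m cokermx M) 0 j != 0.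
  apply: contrapT => H; case/negP: aM; apply/eqP/rowP => j; rewrite [RHS]mxE.
  by apply/eqP; apply: contra_notT H => H; exists j.
pose c := (a *m cokermx M) 0 j.
exists (c^-1 *: (col j (cokermx M))^T); split=> [w /inM|].
  rewrite submxE => /eqP wM; rewrite lin_rat.
  have -> : \sum_i w 0 i * (c^-1 *: (col j (cokermx M))^T) 0 i
    = c^-1 * (w *m cokermx M) 0 j.
    by rewrite mxE mulr_sumr; apply: eq_bigr => i _; rewrite !mxE mulrCA.
  by rewrite wM mxE mulr0 rmorph0.
rewrite lin_rat.
have -> : \sum_i a 0 i * (c^-1 *: (col j (cokermx M))^T) 0 i
  = c^-1 * (a *m cokermx M) 0 j.
  by rewrite [in RHS]mxE mulr_sumr; apply: eq_bigr => i _; rewrite !mxE mulrCA.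
by rewrite mulVf ?rmorph1.
Qed.

Definition lin_norm (ws : seq 'rV[rat]_n) y : R := \sum_(w <- ws) `|lin w y|.

Lemma lin_norm_ge0 ws y : 0 <= lin_norm ws y.
Proof. by apply: sumr_ge0. Qed.

Lemma lin_span ws w : w \in <<ws>>%VS ->
  exists k : nat, forall y, `|lin w y| <= k%:R * lin_norm ws y.
Proof.
move=> /(@coord_span _ _ _ (in_tuple ws)) wE.
have [k kP] : exists k : nat, forall i, `|ratr (coord (in_tuple ws) i w)| <= k%:R :> R.
  (* A uniform natural bound for the coordinates of [w] on the list. *)
  exists (\max_i Num.bound `|ratr (coord (in_tuple ws) i w) : R|) => i.
  by apply: le_trans (ltW (archi_boundP _)) _ => //; rewrite ler_nat; apply: leq_bigmax.
exists k => y; rewrite wE lin_suml (le_trans (ler_norm_sum _ _ _)) //.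
rewrite /lin_norm (big_nth 0) big_mkord mulr_sumr; apply: ler_sum => i _.
by rewrite normrM ler_wpM2r ?kP.
Qed.

Lemma lin_norm_span ws vs : (forall v, v \in vs -> v \in <<ws>>%VS) ->
  exists k : nat, forall y, lin_norm vs y <= k%:R * lin_norm ws y.
Proof.
elim: vs => [|v vs ih] vsP.
  by exists 0%N => y; rewrite /lin_norm big_nil mul0r.
have [k kP] : exists k : nat, forall y, lin_norm vs y <= k%:R * lin_norm ws y.
  by apply: ih => w wvs; apply: vsP; rewrite in_cons wvs orbT.
have [l lP] := lin_span (vsP v (mem_head _ _)); exists (l + k)%N => y.
by rewrite {1}/lin_norm big_cons natrD mulrDl; apply: lerD (lP y) (kP y).
Qed.

Lemma lin_norm0 ws y : (forall w, w \in ws -> lin w y = 0) -> lin_norm ws y = 0.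
Proof. by move=> wy; rewrite /lin_norm big_seq big1 // => w /wy ->; rewrite normr0. Qed.

End LinearForms.

(** * Kernels of functions vanishing on a flat *)

Section Flats.
Variables (R : realType) (F : nuSemifield) (log : logarithm R F) (n : nat).
Variables (u : F) (logu : log u = 1).

Local Notation S := (FLambda F n).
Local Notation val := (fval log).
Local Notation coords := (coords log).
Implicit Types (f g h : S) (x y : point F n) (K A : set S) (s : seq S).
Implicit Types (a v w : 'rV[rat]_n) (W : {vspace 'rV[rat]_n}).

(** Coordinates of points only range over the image of [log], which need not be all of the reals but
    is closed under rational multiples. *)
Lemma translate x (c : F) v :
  exists y : point F n, coords y - coords x = log c *: rat_vec R v.
Proof.
have yP i : exists b : F, log b = ratr (v 0 i) * log c.
  by have [b _ bE] := log_ratr log c (v 0 i); exists b.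
have [b bE] := choice yP; exists (fun i => smul (x i) (b i)).
by apply/rowP => i; rewrite !mxE logM bE addrAC subrr add0r mulrC.
Qed.

Lemma translate1 x v : exists y : point F n, coords y - coords x = rat_vec R v.
Proof. by have [y] := translate x u v; rewrite logu scale1r; exists y. Qed.

Definition affine f a := forall x y, val f x - val f y = lin a (coords x - coords y).

Lemma affine_unique f a b : affine f a -> affine f b -> a = b.
Proof.
move=> fa fb; apply/eqP; rewrite -subr_eq0; apply/negPn/negP => ab.
have /(@separating_vector R)[v [_ ab1]] : a - b \notin (0%VS : {vspace 'rV[rat]_n}).
  by rewrite memv0.
pose o : point F n := fun=> sone; have [y yE] := translate1 o v.
have := fa y o; rewrite (fb y o) yE => ba.
by move: ab1; rewrite linBl ba subrr => /esym/eqP; rewrite oner_eq0.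
Qed.

(** The default 0 concerns functions that are not affine; L-monomials are affine with nonzero
    slope. *)
Definition slope f : 'rV[rat]_n := xget 0 [set a | affine f a].

Lemma slope_eq f a : affine f a -> slope f = a.
Proof. by move=> fa; apply: affine_unique (xgetI 0 fa) fa. Qed.

Lemma affine_mono (h g : monomial F n) :
  affine (Fraction (PMono h) (PMono g)) (\row_i ((mexp h i)%:R - (mexp g i)%:R)).
Proof.
move=> x y; rewrite /fval /= !log_meval /lin.
transitivity (\sum_i (mexp h i)%:R * (log (x i) - log (y i))
  - \sum_i (mexp g i)%:R * (log (x i) - log (y i))); last first.
  rewrite -sumrB; apply: eq_bigr => i _.
  by rewrite !mxE rmorphB !rmorph_nat mulrBl.
have sumB (m : monomial F n) : \sum_i (mexp m i)%:R * (log (x i) - log (y i))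
   = \sum_i (mexp m i)%:R * log (x i) - \sum_i (mexp m i)%:R * log (y i).
  by rewrite -sumrB; apply: eq_bigr => i _; rewrite mulrBr.
by rewrite !sumB; lra.
Qed.

Lemma affine_eqv f g a : eqv f g -> affine g a -> affine f a.
Proof. by move=> /(fval_eqv log) fg ga x y; rewrite !fg. Qed.

Lemma proportional_mono (h g : monomial F n) :
  (forall i, mexp h i = mexp g i) -> proportional h g.
Proof.
move=> hg; have [b bT b1] := tangibleV (proj2_sig (mcoef g)).
exists (tangM (mcoef h) (exist _ b bT)) => x; apply/(log_inj log).
have := congr1 log b1; rewrite logM log1 => /eqP; rewrite addrC addr_eq0 => /eqP bE.
rewrite !(logM, log_meval) /= ?logM bE addrA addrNK; congr (_ + _).
by apply: eq_bigr => i _; rewrite hg.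
Qed.

Lemma Lmonomial_affine f : Lmonomial f -> affine f (slope f) /\ slope f != 0.
Proof.
move=> [h [g [hg fhg]]]; have fa := affine_eqv fhg (affine_mono h g).
rewrite (slope_eq fa); split=> //; apply/eqP => /rowP a0; apply: hg.
apply: proportional_mono => i; have := a0 i; rewrite !mxE => /eqP.
by rewrite subr_eq0 eqr_nat => /eqP.
Qed.

Lemma Lmonomial_val f x y : Lmonomial f -> val f x = val f y + lin (slope f) (coords x - coords y).
Proof. by move=> /Lmonomial_affine[fa _]; rewrite -fa addrC subrK. Qed.

Lemma integral_multiple w : exists2 k : nat, (0 < k)%N &
  forall i, exists z : int, k%:R * w 0 i = z%:~R.
Proof.
exists (\prod_i `|denq (w 0%R i)|)%N => [|i].
  by rewrite prodn_gt0 // => i; rewrite absz_gt0 denq_neq0.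
rewrite (bigD1 i) //=; set r := (\prod_(j | _) _)%N; exists (numq (w 0 i) * r).
rewrite natrM mulrAC intrM -pmulrn; congr (_ * _).
rewrite -[X in _ * X]divq_num_den mulrC pmulrn gez0_abs ?denq_ge0 // divfK //.
by rewrite intr_eq0 denq_neq0.
Qed.

(** An L-monomial has an integral slope, so [w] is reached only up to the factor [k] that clears its
    denominators. *)
Lemma Lmonomial_exists w x : w != 0 ->
  exists f (k : nat), [/\ Lmonomial f, val f x = 0, (0 < k)%N & slope f = k%:R *: w].
Proof.
move=> w_neq0; have [k k_gt0 /choice[z zE]] := integral_multiple w.
pose hexp : {ffun 'I_n -> nat} := [ffun i => if (0 <= z i)%R then `|z i|%N else 0%N].
pose gexp : {ffun 'I_n -> nat} := [ffun i => if (0 <= z i)%R then 0%N else `|z i|%N].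
(* Each monomial gets as coefficient the value at [x] of the power product of the other, so that
   both agree at [x]. *)
have [hc hcE] := log_tangible log (meval (Monomial (tang1 F) gexp) x).
have [gc gcE] := log_tangible log (meval (Monomial (tang1 F) hexp) x).
pose h := Monomial hc hexp; pose g := Monomial gc gexp.
pose f : S := Fraction (PMono h) (PMono g).
have fa : affine f (k%:R *: w).
  have := affine_mono h g; congr (affine _ _); apply/rowP => i.
  rewrite !mxE zE !ffunE /=; case: ifP => zi; rewrite ?subr0 ?sub0r.
    by rewrite pmulrn gez0_abs.
  by rewrite pmulrn ltz0_abs ?rmorphN ?opprK // ltNge zi.
exists f, k; split=> //; last exact: slope_eq.
  exists h, g; split; last by apply/(fval_eqv log).
  (* Proportional monomials have a constant quotient, of slope 0, against the uniqueness of the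
     slope. *)
  move=> [c hgc]; have f0 : affine f 0.
    move=> y1 y2; rewrite lin0l; apply/eqP; rewrite subr_eq0; apply/eqP.
    have fc y : val f y = log (sval c).
      by have /(log_inj log) := hgc y; rewrite logM /fval /= => ->; rewrite addrK.
    by rewrite !fc.
  have /eqP := affine_unique fa f0.
  by rewrite scaler_eq0 pnatr_eq0 -leqn0 leqNgt k_gt0 (negPf w_neq0).
rewrite /fval /= !log_meval /= hcE gcE !log_meval /= log1 !add0r.
by rewrite [X in X - _]addrC subrr.
Qed.

Definition flat x0 W : set S :=
  dominated log (fun x => lin_norm (vbasis W) (coords x - coords x0)).

Lemma flat_kernel x0 W : is_kernel (flat x0 W).
Proof. by apply: dominated_kernel => x; apply: lin_norm_ge0. Qed.

Lemma dominated_le (p q : point F n -> R) (k : nat) :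
  (forall x, p x <= k%:R * q x) -> dominated log p `<=` dominated log q.
Proof.
move=> pq f [l fl]; exists (l * k)%N => x; apply: le_trans (fl x) _.
by rewrite natrM -mulrA ler_wpM2l.
Qed.

Lemma flat_span x0 (ws : seq 'rV[rat]_n) :
  flat x0 <<ws>> = dominated log (fun x => lin_norm ws (coords x - coords x0)).
Proof.
apply/seteqP; split.
  have [|k kP] := @lin_norm_span R n ws (vbasis <<ws>>); first by move=> v /vbasis_mem.
  exact: (dominated_le (k := k)).
have [|k kP] := @lin_norm_span R n (vbasis <<ws>>) ws.
  by move=> v vs; rewrite (span_basis (vbasisP _)) memv_span.
exact: (dominated_le (k := k)).
Qed.

Lemma kgen_flat x0 s :
  (forall f, f \in s -> Lmonomial f) -> (forall f, f \in s -> val f x0 = 0) ->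
  kgen (seqset s) = flat x0 <<map slope s>>.
Proof.
move=> sL s0; rewrite (kgen_seq log) flat_span; congr dominated; apply/funext => x.
rewrite /norm_sum /lin_norm big_map big_seq [RHS]big_seq; apply: eq_bigr => f fs.
by rewrite (Lmonomial_val x x0 (sL f fs)) s0 // add0r.
Qed.

Lemma flat_val0 x0 W f : flat x0 W f -> val f x0 = 0.
Proof.
move=> [k /(_ x0)]; rewrite subrr lin_norm0 => [|w _]; last by rewrite lin0r.
by rewrite mulr0 normr_le0 => /eqP.
Qed.

(** If the slope is outside [W], a translation of [x0] by a vector orthogonal to [W] changes [f] by
    1 while the bound defining the flat stays 0. *)
Lemma flat_Lmonomial x0 W f :
  Lmonomial f -> flat x0 W f <-> val f x0 = 0 /\ slope f \in W.
Proof.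
move=> fL; split=> [fW|[f0 fW]].
  have f0 := flat_val0 fW; split=> //; apply/negPn/negP => /(@separating_vector R)[v [vW fv]].
  have [x xE] := translate1 x0 v; have [k /(_ x)] := fW.
  rewrite (Lmonomial_val x x0 fL) f0 add0r xE fv.
  rewrite lin_norm0 => [|w /vbasis_mem]; last exact: vW.
  by rewrite mulr0 normr1 ler10.
have [|k kP] := @lin_span R n (vbasis W) (slope f); first by rewrite (span_basis (vbasisP _)).
by exists k => x; rewrite (Lmonomial_val x x0 fL) f0 add0r.
Qed.

(** L-monomials vanishing at [x0] detect [W]: each nonzero vector is the slope of one of them up to
    a positive factor. *)
Lemma flatS x0 W W' : (flat x0 W `<=` flat x0 W') <-> (W <= W')%VS.
Proof.
split=> [WW'|WW'].
  apply/subvP => w wW; have [->|w_neq0] := eqVneq w 0; first by rewrite mem0v.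
  have [f [k [fL f0 k_gt0 fw]]] := Lmonomial_exists x0 w_neq0.
  have : flat x0 W f by apply/flat_Lmonomial => //; rewrite f0 fw memvZ.
  move=> /WW' /flat_Lmonomial[]// _; rewrite fw rpredZeq pnatr_eq0.
  by rewrite -leqn0 leqNgt k_gt0.
have [|k kP] := @lin_norm_span R n (vbasis W') (vbasis W).
  by move=> v /vbasis_mem vW; rewrite (span_basis (vbasisP _)); apply: (subvP WW').
exact: (dominated_le (k := k)).
Qed.

Lemma flat_proper x0 W : F_proper (flat x0 W).
Proof.
by move=> c /flat_val0; rewrite fval_fconst -(log1 log) => /(log_inj log).
Qed.

Lemma slope_basis x0 W : exists s,
  [/\ forall f, f \in s -> Lmonomial f, forall f, f \in s -> val f x0 = 0 &
      basis_of W (map slope s)].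
Proof.
have [|s [sL s0 sW szs]] : (forall w, w \in (vbasis W : seq _) -> w != 0) ->
    exists s, [/\ forall f, f \in s -> Lmonomial f, forall f, f \in s -> val f x0 = 0,
      <<map slope s>>%VS = <<vbasis W>>%VS & size s = size (vbasis W)]; last first.
- exists s; split=> //; rewrite basisEdim sW (span_basis (vbasisP W)) subvv.
  by rewrite size_map szs size_tuple /=.
- by move=> w wW; exact: free_not0 (basis_free (vbasisP W)) wW.
elim: {W}(vbasis W : seq _) => [|w ws ih] wsP; first by exists [::].
have [|s [sL s0 sW szs]] := ih; first by move=> v vs; apply: wsP; rewrite in_cons vs orbT.
have [f [k [fL f0 k_gt0 fw]]] := Lmonomial_exists x0 (wsP w (mem_head _ _)).
exists (f :: s); split.
- by move=> g; rewrite in_cons => /orP[/eqP->|/sL].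
- by move=> g; rewrite in_cons => /orP[/eqP->|/s0].
- rewrite /= !span_cons sW fw; congr (_ + _)%VS.
  have k_neq0 : (k%:R : rat) != 0 by rewrite pnatr_eq0 -lt0n.
  apply/eqP; rewrite eqEsubv -!memvE memvZ ?memv_line //=.
  by rewrite -[X in X \in _](scalerK k_neq0) memvZ ?memv_line.
- by rewrite /= szs.
Qed.

Lemma flat_generators x0 W : exists s,
  [/\ forall f, f \in s -> Lmonomial f, forall f, f \in s -> val f x0 = 0,
      basis_of W (map slope s) & flat x0 W = kgen (seqset s)].
Proof.
have [s [sL s0 sW]] := slope_basis x0 W.
by exists s; split=> //; rewrite (kgen_flat sL s0) (span_basis sW).
Qed.

End Flats.

(** * The irreducible kernels *)

Section Spectrum.
Variables (R : realType) (F : nuSemifield) (log : logarithm R F) (n : nat).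

Local Notation S := (FLambda F n).
Local Notation val := (fval log).
Local Notation coords := (coords log).
Local Notation slope := (@slope R F log n).
Implicit Types (f g h : S) (x y : point F n) (K L : set S) (s : seq S).
Implicit Types (a v w : 'rV[rat]_n) (W : {vspace 'rV[rat]_n}).

Lemma fmin_fabsl f g x : `|val (fmin (fabs f) (fabs g)) x| <= `|val f x|.
Proof. by rewrite fval_fmin !fval_fabs ger0_norm ?le_min ?normr_ge0 // ge_min lexx. Qed.

Lemma fmin_fabsr f g x : `|val (fmin (fabs f) (fabs g)) x| <= `|val g x|.
Proof. by rewrite fval_fmin !fval_fabs ger0_norm ?le_min ?normr_ge0 // ge_min lexx orbT. Qed.

Lemma kgen_setI f g :
  kgen [set f] `&` kgen [set g] = kgen [set fmin (fabs f) (fabs g)].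
Proof.
rewrite !(kgen1 log); apply/seteqP; split=> h.
  move=> [[k hf] [l hg]]; exists (k + l)%N => x; rewrite fval_fmin !fval_fabs.
  rewrite [X in _ * X]ger0_norm ?le_min ?normr_ge0 // natrD mulrDl.
  have [_|_] := leP `|val f x| `|val g x|.
    by apply: le_trans (hf x) _; rewrite lerDl mulr_ge0.
  by apply: le_trans (hg x) _; rewrite lerDr mulr_ge0.
move=> [k hk]; split; exists k => x; apply: le_trans (hk x) _; apply: ler_wpM2l => //.
  exact: fmin_fabsl.
exact: fmin_fabsr.
Qed.

Lemma kgen_kprod f g :
  kprod (kgen [set f]) (kgen [set g]) = kgen [set fmul (fabs f) (fabs g)].
Proof.
have [Kf Kg] := (kgen_kernel [set f], kgen_kernel [set g]).
have Kfg := kgen_kernel [set fmul (fabs f) (fabs g)].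
have KK := kprod_kernel log Kf Kg.
apply/seteqP; split.
  have Kself : kgen [set fmul (fabs f) (fabs g)] (fmul (fabs f) (fabs g)) by apply: sub_kgen.
  apply: (kprod_sub log Kfg); apply: (kgen_sub Kfg) => _ ->;
    apply: (ker_dominated log Kfg Kself) => x; rewrite fvalM !fval_fabs.
    by rewrite [leRHS]ger0_norm ?addr_ge0 // lerDl.
  by rewrite [leRHS]ger0_norm ?addr_ge0 // lerDr.
apply: (kgen_sub KK) => h ->; apply: (kerM KK).
  by apply: (kprod_subl log Kf Kg); apply: (ker_abs log Kf); apply: sub_kgen.
by apply: (kprod_subr log Kf Kg); apply: (ker_abs log Kg); apply: sub_kgen.
Qed.

(** Reducibility is stated for principal kernels; this makes it applicable to every member of
    [Omega]. *)
Lemma Omega_principal K : Omega K -> exists g, K = kgen [set g].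
Proof.
elim=> [|f _|K1 K2 _ [g1 ->] _ [g2 ->]|K1 K2 _ [g1 ->] _ [g2 ->]].
- by exists fone.
- by exists f.
- by exists (fmin (fabs g1) (fabs g2)); apply: kgen_setI.
- by exists (fmul (fabs g1) (fabs g2)); apply: kgen_kprod.
Qed.

Lemma Omega_kernel K : Omega K -> is_kernel K.
Proof. by move=> /Omega_principal[g ->]; apply: kgen_kernel. Qed.

Lemma irreducible_setI K1 K2 L : ~ reducible L -> Omega K1 -> Omega K2 ->
  K1 `&` K2 `<=` L -> K1 `<=` L \/ K2 `<=` L.
Proof.
move=> Lirr O1 O2 K12; apply: contrapT => /not_orP[N1 N2]; apply: Lirr.
have [g1 E1] := Omega_principal O1; have [g2 E2] := Omega_principal O2.
by exists g1, g2; split; rewrite -?E1 -?E2.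
Qed.

Lemma seqset_cons f s K : f \in K -> seqset s `<=` K -> seqset (f :: s) `<=` K.
Proof.
move=> /set_mem Kf sK g; rewrite /seqset /= in_cons => /orP[/eqP->//|]; exact: sK.
Qed.

Lemma kgen_seqset_cons f s :
  kgen (seqset (f :: s)) = kprod (kgen [set f]) (kgen (seqset s)).
Proof.
have [Kf Ks] := (kgen_kernel [set f], kgen_kernel (seqset s)).
have Kfs := kgen_kernel (seqset (f :: s)).
apply/seteqP; split.
  apply: (kgen_sub (kprod_kernel log Kf Ks)); apply: seqset_cons.
    by apply/mem_set/(kprod_subl log Kf Ks); apply: sub_kgen.
  by move=> g gs; apply: (kprod_subr log Kf Ks); apply: sub_kgen.
apply: (kprod_sub log Kfs).
  by apply: (kgen_sub Kfs) => g ->; apply: sub_kgen; rewrite /seqset /= mem_head.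
apply: (kgen_sub Kfs) => g gs; apply: sub_kgen.
by rewrite /seqset /= in_cons; apply/orP; right.
Qed.

Lemma kgen_seqset_nil : kgen (seqset [::]) = kgen [set (fone : S)].
Proof.
apply/seteqP; split; first by apply: (kgen_sub (kgen_kernel _)).
by apply: (kgen_sub (kgen_kernel _)) => g ->; apply: (ker1 (kgen_kernel _)).
Qed.

Lemma Omega_seqset s : (forall f, f \in s -> Lmonomial f) -> Omega (kgen (seqset s)).
Proof.
elim: s => [|f s ih] sL; first by rewrite kgen_seqset_nil; apply: Omega1.
rewrite kgen_seqset_cons; apply: OmegaM.
  by apply: OmegaHP; apply: sL; rewrite mem_head.
by apply: ih => g gs; apply: sL; rewrite in_cons gs orbT.
Qed.

(** Induction on the construction of [K]. Irreducibility of [L] puts one term of an intersection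
    inside [L]; both factors of a product are inside [L], and their lists are concatenated. The case
    [K = L] removes intersections from [L]. *)
Lemma Omega_under_irreducible K L : is_kernel L -> ~ reducible L ->
  Omega K -> K `<=` L ->
  exists s, [/\ forall f, f \in s -> Lmonomial f, K `<=` kgen (seqset s) &
                kgen (seqset s) `<=` L].
Proof.
move=> KL Lirr; elim=> [|f fL|K1 K2 O1 ih1 O2 ih2|K1 K2 O1 ih1 O2 ih2] K_L.
- by exists [::]; rewrite kgen_seqset_nil; split=> // f; rewrite in_nil.
- exists [:: f]; split=> [g||]; first by rewrite mem_seq1 => /eqP->.
    by apply: (kgen_sub (kgen_kernel _)) => g ->; apply: sub_kgen; rewrite /seqset /= mem_head.
  apply: (kgen_sub KL) => g; rewrite /seqset /= mem_seq1 => /eqP ->.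
  by apply: K_L; apply: sub_kgen.
- have [/ih1|/ih2] := irreducible_setI Lirr O1 O2 K_L.
    by move=> [s [sL Ks sK]]; exists s; split=> // g [+ _]; apply: Ks.
  by move=> [s [sL Ks sK]]; exists s; split=> // g [_]; apply: Ks.
- have [KK1 KK2] := (Omega_kernel O1, Omega_kernel O2).
  have [|s1 [sL1 Ks1 sK1]] := ih1; first by move=> g /(kprod_subl log KK1 KK2)/K_L.
  have [|s2 [sL2 Ks2 sK2]] := ih2; first by move=> g /(kprod_subr log KK1 KK2)/K_L.
  exists (s1 ++ s2); split.
  + by move=> f; rewrite mem_cat => /orP[/sL1|/sL2].
  + apply: (kprod_sub log (kgen_kernel _)).
      apply: subset_trans Ks1 _; apply: (kgen_sub (kgen_kernel _)) => g gs.
      by apply: sub_kgen; rewrite /seqset /= mem_cat; apply/orP; left.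
    apply: subset_trans Ks2 _; apply: (kgen_sub (kgen_kernel _)) => g gs.
    by apply: sub_kgen; rewrite /seqset /= mem_cat; apply/orP; right.
  + apply: (kgen_sub KL) => g; rewrite /seqset /= mem_cat => /orP[gs|gs].
      by apply: sK1; apply: sub_kgen.
    by apply: sK2; apply: sub_kgen.
Qed.

Lemma HSpec_generators L : HSpec L ->
  exists s, (forall f, f \in s -> Lmonomial f) /\ L = kgen (seqset s).
Proof.
move=> [OL Lirr _].
have [s [sL Ls sK]] := Omega_under_irreducible (Omega_kernel OL) Lirr OL (@subset_refl _ L).
by exists s; split=> //; apply/seteqP.
Qed.

Variables (u : F) (logu : log u = 1).

(** Let [x0] be a zero of the tail. If the slope of [f] depends on the others, the constant [f(x0)]
    lies in the kernel and is trivial by properness. Otherwise [x0] can be moved to a zero of [f] in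
    a direction killed by the other slopes. *)
Lemma common_zero s : (forall f, f \in s -> Lmonomial f) ->
  F_proper (kgen (seqset s)) -> exists x0, forall f, f \in s -> val f x0 = 0.
Proof.
elim: s => [|f s ih] sL sP; first by exists (fun=> sone).
have [|c sc|x0 x0s] := ih.
- by move=> g gs; apply: sL; rewrite in_cons gs orbT.
- apply: sP; apply: (kgen_sub (kgen_kernel _)) sc => g gs; apply: sub_kgen.
  by rewrite /seqset /= in_cons; apply/orP; right.
have fL : Lmonomial f by apply: sL; rewrite mem_head.
have sL' g : g \in s -> Lmonomial g by move=> gs; apply: sL; rewrite in_cons gs orbT.
have [fs|/(@separating_vector R)[v [vs fv]]] := boolP (slope f \in <<map slope s>>%VS).
  exists x0 => g; rewrite in_cons => /orP[/eqP-> |]; last exact: x0s.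
  have [k kP] := @lin_span R _ _ _ fs.
  have [c cf] := fval_tangible log f x0.
  rewrite -cf -(log1 log); apply/(log_inj log)/sP.
  (* The value at [x0] is at most the value at [x] plus [k] times the sum over [s], in absolute
     values; [k.+1] serves both terms. *)
  rewrite (kgen_seq log); exists k.+1 => x; rewrite fval_fconst cf.
  have -> : val f x0 = val f x - lin (slope f) (coords x - coords x0).
    by rewrite (Lmonomial_val logu x x0 fL) addrK.
  have ns : lin_norm (map slope s) (coords x - coords x0) = norm_sum log s x.
    rewrite /norm_sum /lin_norm big_map big_seq [RHS]big_seq; apply: eq_bigr => h hs.
    by rewrite (Lmonomial_val logu x x0 (sL' h hs)) x0s // add0r.
  apply: le_trans (ler_normB _ _) _.
  rewrite /norm_sum big_cons -/(norm_sum log s x) mulrDr; apply: lerD.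
    by rewrite ler_peMl // ler1n.
  apply: le_trans (kP _) _; rewrite ns ler_wpM2r ?norm_sum_ge0 //.
  by rewrite ler_nat.
have [c' c'f] := fval_tangible log f x0; have [c] := log_opp log (sval c').
rewrite c'f => cf.
have [x1 x1E] := translate log x0 c v; exists x1 => g; rewrite in_cons.
move=> /orP[/eqP->|gs].
  by rewrite (Lmonomial_val logu x1 x0 fL) x1E linZr fv mulr1 cf subrr.
rewrite (Lmonomial_val logu x1 x0 (sL' g gs)) x0s // x1E linZr.
by rewrite vs ?mulr0 ?addr0 // memv_span // map_f.
Qed.

(** The base point may be any common zero, so all members of a chain can share one. *)
Lemma HSpec_flat_at L x0 : HSpec L -> (forall f, L f -> val f x0 = 0) ->
  exists W, L = flat log x0 W.
Proof.
move=> /HSpec_generators[s [sL ->]] L0; exists <<map slope s>>%VS.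
by apply: (kgen_flat logu) => // f fs; apply: L0; apply: sub_kgen.
Qed.

Lemma HSpec_flat L : HSpec L -> exists x0 W, L = flat log x0 W.
Proof.
move=> HL; have [s [sL LE]] := HSpec_generators HL; have [_ _] := HL.
rewrite LE => /(common_zero sL)[x0 x0s]; exists x0, <<map slope s>>%VS.
exact: (kgen_flat logu).
Qed.

Lemma line x y (k : nat) :
  exists z : point F n, coords z - coords x = k%:R *: (coords y - coords x).
Proof.
have bP i := log_opp log (x i).
have [b bE] := choice bP; exists (fun i => smul (x i) (spow (smul (y i) (b i)) k)).
by apply/rowP => i; rewrite !mxE logM log_spow logM bE addrAC subrr add0r.
Qed.

(** A pair stands for an affine function of [k]. If it is nonzero somewhere, it has at most one
    zero, hence none for large [k]. *)
Lemma affine_common_nonzero (l : seq (R * R)) :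
  (forall p, p \in l -> exists k : nat, p.1 + k%:R * p.2 != 0) ->
  exists N : nat, forall k, (N <= k)%N -> forall p, p \in l -> p.1 + k%:R * p.2 != 0.
Proof.
elim: l => [|[c d] l ih] lP; first by exists 0%N.
have [|N NP] := ih; first by move=> p pl; apply: lP; rewrite in_cons pl orbT.
have [M MP] : exists M, forall k, (M <= k)%N -> c + k%:R * d != 0.
  have [j] := lP _ (mem_head _ _); have [->|d_neq0] := eqVneq d 0.
    by move=> cj; exists 0%N => k _; move: cj; rewrite /= !mulr0.
  move=> _; exists (Num.bound `|c / d|) => k Mk; apply/negP => /eqP kE.
  have cdE : `|c / d| = k%:R.
    have -> : c = - k%:R * d by move/eqP: kE; rewrite addr_eq0 mulNr => /eqP.
    by rewrite mulfK // normrN normr_nat.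
  by have := archi_boundP (normr_ge0 (c / d)); rewrite {1}cdE ltr_nat ltnNge Mk.
exists (maxn M N) => k; rewrite geq_max => /andP[Mk Nk] p.
by rewrite in_cons => /orP[/eqP->|/(NP k Nk)//]; apply: MP.
Qed.

(** The affine subspace is not covered by finitely many proper zero sets: if [x] avoids those of [s]
    and [y] that of [f], then a point far out on the line through them avoids all. *)
Lemma flat_common_nonzero x0 W s :
  (forall f, f \in s -> Lmonomial f /\ ~ flat log x0 W f) ->
  exists x, (forall w, w \in W -> lin w (coords x - coords x0) = 0) /\
            (forall f, f \in s -> val f x != 0).
Proof.
elim: s => [|f s ih] sP.
  by exists x0; split=> // w _; rewrite subrr lin0r.
have [|x [xW xs]] := ih; first by move=> g gs; apply: sP; rewrite in_cons gs orbT.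
have [fL fW] := sP f (mem_head _ _).
have [y [yW fy]] : exists y, (forall w, w \in W -> lin w (coords y - coords x0) = 0) /\
    val f y != 0.
  have [f0|f0] := eqVneq (val f x0) 0; last first.
    by exists x0; split=> // w _; rewrite subrr lin0r.
  have /(@separating_vector R)[v [vW fv]] : slope f \notin W.
    by apply/negP => fsW; apply: fW; apply/(flat_Lmonomial logu).
  have [y yE] := translate1 logu x0 v; exists y.
  rewrite (Lmonomial_val logu y x0 fL) f0 add0r yE fv oner_neq0.
  by split.
have sL g : g \in f :: s -> Lmonomial g by move=> /sP[].
pose l := [seq (val g x, val g y - val g x) | g <- f :: s].
have [|N /(_ N (leqnn N)) NP] := @affine_common_nonzero l.
  move=> p /mapP[g]; rewrite in_cons => /orP[/eqP->|gs] -> /=.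
    by exists 1%N; rewrite mul1r addrC subrK.
  by exists 0%N; rewrite mul0r addr0 xs.
have [z zE] := line x y N; exists z; split=> [w wW|g gs].
  rewrite -[coords z](subrK (coords x)) zE -addrA linDr linZr xW // addr0.
  have -> : coords y - coords x = (coords y - coords x0) - (coords x - coords x0).
    by rewrite opprB addrA subrK.
  by rewrite linBr xW // yW // subrr mulr0.
rewrite (Lmonomial_val logu z x (sL g gs)) zE linZr.
have -> : lin (slope g) (coords y - coords x) = val g y - val g x.
  by apply/eqP; rewrite eq_sym subr_eq (Lmonomial_val logu y x (sL g gs)) addrC.
by apply: (NP (val g x, val g y - val g x)); apply/mapP; exists g.
Qed.

(** The witness [g] can vanish only where some L-monomial outside the flat does. An intersection
    combines the witnesses of both terms by a minimum; for a product, the factor not inside the flat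
    suffices. *)
Lemma Omega_nonzero x0 W K : Omega K -> ~ K `<=` flat log x0 W ->
  exists s g, [/\ forall f, f \in s -> Lmonomial f /\ ~ flat log x0 W f, K g &
    forall x, (forall f, f \in s -> val f x != 0) -> val g x != 0].
Proof.
have KW := flat_kernel log x0 W.
elim=> [|f fL|K1 K2 O1 ih1 O2 ih2|K1 K2 O1 ih1 O2 ih2] K_W.
- by case: K_W; apply: (kgen_sub KW) => g ->; apply: (ker1 KW).
- exists [:: f], f; split=> [g||x]; last by apply; rewrite mem_head.
    rewrite mem_seq1 => /eqP->; split=> // fW; apply: K_W.
    by apply: (kgen_sub KW) => _ ->.
  exact: sub_kgen.
- have [|s1 [g1 [s1P Kg1 g1P]]] := ih1; first by move=> K1W; apply: K_W => f [/K1W].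
  have [|s2 [g2 [s2P Kg2 g2P]]] := ih2; first by move=> K2W; apply: K_W => f [_ /K2W].
  exists (s1 ++ s2), (fmin (fabs g1) (fabs g2)); split.
  + by move=> f; rewrite mem_cat => /orP[/s1P|/s2P].
  + split.
      apply: (ker_dominated log (Omega_kernel O1) Kg1) => x.
      exact: fmin_fabsl.
    apply: (ker_dominated log (Omega_kernel O2) Kg2) => x.
    exact: fmin_fabsr.
  + move=> x xs; rewrite fval_fmin !fval_fabs; apply: lt0r_neq0.
    rewrite lt_min !normr_gt0 g1P ?g2P // => f fs; apply: xs.
      by rewrite mem_cat fs orbT.
    by rewrite mem_cat fs.
- have [KK1 KK2] := (Omega_kernel O1, Omega_kernel O2).
  have [K1W|/ih1[s [g [sP Kg gP]]]] := pselect (K1 `<=` flat log x0 W); last first.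
    by exists s, g; split=> //; apply: (kprod_subl log KK1 KK2).
  have [K2W|/ih2[s [g [sP Kg gP]]]] := pselect (K2 `<=` flat log x0 W); last first.
    by exists s, g; split=> //; apply: (kprod_subr log KK1 KK2).
  by case: K_W; apply: (kprod_sub log KW).
Qed.

Lemma flat_HSpec x0 W : HSpec (flat log x0 W).
Proof.
split.
- by have [s [sL _ _ ->]] := flat_generators logu x0 W; apply: Omega_seqset.
- move=> [g [h [Og Oh gW hW ghW]]].
  have [s1 [g1 [s1P Kg1 g1P]]] := Omega_nonzero Og gW.
  have [s2 [g2 [s2P Kg2 g2P]]] := Omega_nonzero Oh hW.
  (* At such a point both witnesses are nonzero, hence so is the minimum of their absolute values;
     but every member of the flat vanishes there. *)
  have [|x [xW xs]] := @flat_common_nonzero x0 W (s1 ++ s2).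
    by move=> f; rewrite mem_cat => /orP[/s1P|/s2P].
  have : flat log x0 W (fmin (fabs g1) (fabs g2)).
    apply: ghW; split.
      apply: (ker_dominated log (Omega_kernel Og) Kg1) => y.
      exact: fmin_fabsl.
    apply: (ker_dominated log (Omega_kernel Oh) Kg2) => y.
    exact: fmin_fabsr.
  move=> [k /(_ x)]; rewrite lin_norm0 => [|w /vbasis_mem]; last exact: xW.
  rewrite mulr0 normr_le0 fval_fmin !fval_fabs; apply/negP/lt0r_neq0.
  rewrite lt_min !normr_gt0 g1P ?g2P // => f fs; apply: xs.
    by rewrite mem_cat fs orbT.
  by rewrite mem_cat fs.
- exact: flat_proper.
Qed.

End Spectrum.

(** * Convex dimension *)

Section ConvexDimension.
Variables (R : realType) (F : nuSemifield) (log : logarithm R F) (n : nat).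
Variables (u : F) (logu : log u = 1).

Local Notation S := (FLambda F n).
Local Notation val := (fval log).
Local Notation coords := (coords log).
Local Notation slope := (@slope R F log n).
Local Notation flat := (@flat R F log n).
Implicit Types (f g h : S) (x y : point F n) (K L A B : set S) (s t : seq S).
Implicit Types (a v w : 'rV[rat]_n) (W : {vspace 'rV[rat]_n}).

Lemma kerF_dominated : @kerF F n = dominated log (fun=> 1).
Proof.
apply/seteqP; split.
  apply: kgen_sub; first by apply: dominated_kernel.
  move=> _ [c _ <-]; exists (Num.bound `|log (sval c)|) => x.
  by rewrite fval_fconst mulr1 ltW // archi_boundP.
move=> f [k fk]; have [c cE] := log_tangible log u.
have KF := kgen_kernel (range (fconst n : tang F -> S)).
have Kc : @kerF F n (fconst n c) by apply: sub_kgen; exists c.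
apply: (ker_dominated log KF (ker_exp k KF Kc)) => x.
by rewrite fval_fexp fval_fconst cE logu [leRHS]ger0_norm ?mulr1 // -[k%:R]mulr1.
Qed.

Lemma kerF_kernel : is_kernel (@kerF F n).
Proof. exact: kgen_kernel. Qed.

(** Up to a constant, an L-monomial is its linear part, and constants are absorbed by [kerF]. The
    constant [C] below collects the values at the origin. *)
Lemma slope_span_dependent A s f :
  (forall g, g \in s -> A g /\ Lmonomial g) -> Lmonomial f ->
  slope f \in <<map slope s>>%VS -> convexly_dependent A f.
Proof.
move=> sA fL /(@lin_span R)[k kP].
pose o : point F n := fun=> sone.
pose C : R := `|val f o| + k%:R * norm_sum log s o.
apply/(kprodP log _ (kgen_kernel A) kerF_kernel).
have [c cE] := log_tangible log u.
exists (fexp (fnorm s) k), (fexp (fconst n c) (Num.bound C)); split.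
- apply: ker_exp (kgen_kernel A) _; apply: (ker_norm log (kgen_kernel A)) => g gs.
  by apply: sub_kgen; case: (sA g gs).
- by apply: ker_exp kerF_kernel _; apply: sub_kgen; exists c.
- move=> x; rewrite !fval_fexp fval_fnorm fval_fconst cE logu mulr1.
  rewrite [X in _ <= X + _]ger0_norm ?mulr_ge0 ?sumr_ge0 // [X in _ <= _ + X]ger0_norm //.
  have C_ge0 : 0 <= C by rewrite addr_ge0 ?mulr_ge0 ?norm_sum_ge0.
  apply: le_trans (_ : _ <= k%:R * norm_sum log s x + C) _; last first.
    by rewrite lerD2l ltW // archi_boundP.
  rewrite (Lmonomial_val logu x o fL) /C addrCA (le_trans (ler_normD _ _)) // lerD2l.
  apply: le_trans (kP _) _; rewrite -mulrDr ler_wpM2l //.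
  rewrite /lin_norm big_map /norm_sum -big_split /= big_seq [leRHS]big_seq.
  apply: ler_sum => g gs; have [_ gL] := sA g gs.
  have -> : lin (slope g) (coords x - coords o) = val g x - val g o.
    by apply/eqP; rewrite eq_sym subr_eq (Lmonomial_val logu x o gL) addrC.
  exact: ler_normB.
Qed.

(** Along a direction killed by the slopes of [s] but not by that of [f], the function [f] is
    unbounded, whereas the bound given by dependence stays constant. Going [N] steps, with [N]
    beyond [C], is enough. *)
Lemma dependent_slope_span s f : (forall g, g \in s -> Lmonomial g) ->
  Lmonomial f -> convexly_dependent (kgen (seqset s)) f ->
  slope f \in <<map slope s>>%VS.
Proof.
move=> sL fL /(kprodP log _ (kgen_kernel _) kerF_kernel)[g1 [g2 [Kg1 Kg2 fg]]].
have {Kg1} : kgen (seqset s) g1.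
  by apply: Kg1; [exact: kgen_kernel|exact: subset_refl].
rewrite (kgen_seq log) => -[k g1k].
move: Kg2; rewrite kerF_dominated => -[m g2m].
apply/negPn/negP => /(@separating_vector R)[v [vs fv]].
pose o : point F n := fun=> sone.
pose C : R := `|val f o| + (k%:R * norm_sum log s o + m%:R).
have C_ge0 : 0 <= C by rewrite !addr_ge0 ?mulr_ge0 ?norm_sum_ge0.
pose N := Num.bound C; have [x xE] := translate log o (spow u N) v.
have lN : log (spow u N) = N%:R by rewrite log_spow logu mulr1.
have fx : val f x = val f o + N%:R.
  by rewrite (Lmonomial_val logu x o fL) xE linZr fv mulr1 lN.
have sx : norm_sum log s x = norm_sum log s o.
  rewrite /norm_sum big_seq [RHS]big_seq; apply: eq_bigr => g gs.
  rewrite (Lmonomial_val logu x o (sL g gs)) xE linZr vs ?mulr0 ?addr0 //.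
  by rewrite memv_span // map_f.
have : N%:R <= C.
  have -> : N%:R = val f x - val f o by rewrite fx [X in X - _]addrC addrK.
  apply: le_trans (ler_norm _) _; apply: le_trans (ler_normB _ _) _.
  rewrite addrC lerD2l; apply: le_trans (fg x) _; rewrite lerD //.
    by rewrite -sx.
  by have := g2m x; rewrite mulr1.
by apply/negP; rewrite -ltNge archi_boundP.
Qed.

Lemma convexly_dependentP A f : A `<=` @Lmonomial F n -> Lmonomial f ->
  convexly_dependent A f <->
  exists s, (forall g, g \in s -> A g) /\ slope f \in <<map slope s>>%VS.
Proof.
move=> AL fL; split=> [|[s [sA fs]]]; last first.
  by apply: slope_span_dependent fs => // g gs; split; [|apply: AL]; apply: sA.
move=> [g1 [g2 [/kgenP[s [sA sg1]] Kg2 fg]]]; exists s; split=> //.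
apply: dependent_slope_span => //; first by move=> g /sA/AL.
by exists g1, g2; split=> //; apply: sub_kgen.
Qed.

Lemma flat_dependentP x0 W f : Lmonomial f ->
  convexly_dependent (flat x0 W) f <-> slope f \in W.
Proof.
move=> fL; have [s [sL s0 sW ->]] := flat_generators logu x0 W.
rewrite -(span_basis sW); split; first exact: dependent_slope_span.
by apply: slope_span_dependent => // g gs; split; [apply: sub_kgen|apply: sL].
Qed.

Lemma convexly_independentP B : B `<=` @Lmonomial F n ->
  convexly_independent B <->
  forall s, uniq s -> (forall f, f \in s -> B f) -> free (map slope s).
Proof.
move=> BL; split=> [Bind|Bfree f Bf].
  elim=> [|f s ih] /= => [_ _|/andP[fs us] sB]; first exact: nil_free.
  have Bs g : g \in s -> B g by move=> gs; apply: sB; rewrite in_cons gs orbT.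
  rewrite free_cons ih // andbT; apply/negP => fspan.
  have Bf : B f by apply: sB; rewrite mem_head.
  case: (Bind f Bf); apply: slope_span_dependent fspan; last exact: BL.
  move=> g gs; split; last exact/BL/Bs.
  by split; [exact: Bs|move=> /= gf; move: fs; rewrite -gf gs].
move=> /convexly_dependentP-/(_ (fun g Bg => BL g Bg.1) (BL f Bf))[s [sB fs]].
have := Bfree (f :: undup s); rewrite /= undup_uniq mem_undup andbT free_cons.
have -> : f \notin s by apply/negP => /sB[_]; apply.
have -> : <<map slope (undup s)>>%VS = <<map slope s>>%VS.
  by apply/eq_span/eq_mem_map/mem_undup.
rewrite fs /= => H; apply: notF; apply: H => //.
by move=> g; rewrite in_cons mem_undup => /orP[/eqP->//|/sB[]].
Qed.

Lemma card_seqset s : uniq s -> (seqset s #= `I_(size s))%card.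
Proof.
move=> us; apply/card_set_bijP; exists (fun f => index f s); split.
- by move=> f fs; rewrite /= index_mem.
- move=> f g /set_mem fs /set_mem gs fg.
  by rewrite -[f](nth_index (fone : S) fs) fg nth_index.
- by move=> i /= i_lt; exists (nth (fone : S) s i); rewrite ?index_uniq //; apply: mem_nth.
Qed.

Lemma free_sub s t : free (map slope s) -> uniq t -> (forall f, f \in t -> f \in s) ->
  free (map slope t).
Proof.
move=> sfree ut ts; have us : uniq s by apply: map_uniq (free_uniq sfree).
have pt : perm_eq t (filter (mem t) s).
  apply: uniq_perm; rewrite ?filter_uniq // => f; rewrite mem_filter /=.
  by case: (boolP (f \in t)) => //= /ts ->.
rewrite (perm_free (perm_map slope pt)).
have /(perm_map slope)/perm_free := permEl (perm_filterC (mem t) s).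
by rewrite map_cat sfree => /catl_free.
Qed.

Lemma convex_span_flat x0 W :
  convex_span (flat x0 W) = [set f | Lmonomial f /\ slope f \in W].
Proof.
by apply/seteqP; split=> f [fL] => /(flat_dependentP x0 W fL).
Qed.

Lemma convex_basis_exists x0 W : exists B, convex_basis (convex_span (flat x0 W)) B.
Proof.
have [s [sL _ sW]] := slope_basis logu x0 W; exists (seqset s).
have us : uniq s by apply: map_uniq (free_uniq (basis_free sW)).
rewrite convex_span_flat; split=> [f fs||B' B'V B'ind sB'].
- by split; [exact: sL|rewrite -(span_basis sW) memv_span // map_f].
- apply/convexly_independentP => [|t ut ts]; first exact: sL.
  exact: free_sub (basis_free sW) ut ts.
- have B'L : B' `<=` @Lmonomial F n by move=> f /B'V[].
  apply/seteqP; split=> // f B'f; apply: contrapT => /negP fs.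
  have := (convexly_independentP B'L).1 B'ind (f :: s).
  rewrite /= fs us free_cons (span_basis sW) (B'V f B'f).2 => H.
  apply: notF; apply: H => // g.
  by rewrite in_cons => /orP[/eqP->|/sB'].
Qed.

(** The set [B] is not known to be finite at first, but its finite subsets have free slopes in [W],
    so their size is bounded and a largest one exhausts [B]. *)
Lemma convex_basis_card x0 W B : convex_basis (convex_span (flat x0 W)) B ->
  (B #= `I_(\dim W))%card.
Proof.
rewrite convex_span_flat => -[BV Bind Bmax].
have BL : B `<=` @Lmonomial F n by move=> f /BV[].
have Bfree := (convexly_independentP BL).1 Bind.
have sub_W s : (forall f, f \in s -> B f) -> (<<map slope s>> <= W)%VS.
  by move=> sB; apply/span_subvP => w /mapP[f /sB/BV[_ fW] ->].
have size_le s : uniq s -> (forall f, f \in s -> B f) -> (size s <= \dim W)%N.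
  move=> us sB; have /eqP := Bfree s us sB; rewrite size_map => <-.
  exact/dimvS/sub_W.
pose P m := `[< exists s, [/\ uniq s, forall f, f \in s -> B f & size s = m] >].
have exP : exists m, P m by exists 0%N; apply/asboolP; exists [::].
have Pub m : P m -> (m <= \dim W)%N by move=> /asboolP[s [us sB <-]]; apply: size_le.
case: (ex_maxnP exP Pub) => m /asboolP[s [us sB sm]] mmax.
have BE : B = seqset s.
  apply/seteqP; split=> [f Bf|f /sB//]; apply: contrapT => /negP fs.
  have : P m.+1.
    apply/asboolP; exists (f :: s); split; rewrite /= ?fs ?sm //.
    by move=> g; rewrite in_cons => /orP[/eqP->|/sB].
  by move=> /mmax; rewrite ltnn.
have sfree := Bfree s us sB.
have spanW : <<map slope s>>%VS = W.
  (* Otherwise an L-monomial whose slope lies in [W] but outside the span could be added to [B],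
     against maximality. *)
  apply/eqP; rewrite eqEsubv sub_W //=; apply/negPn/negP => /subvPn[w wW ws].
  have w_neq0 : w != 0 by apply: contraNneq ws => ->; rewrite mem0v.
  have [f [k [fL _ k_gt0 fw]]] := Lmonomial_exists logu x0 w_neq0.
  have fs : slope f \notin <<map slope s>>%VS.
    by rewrite fw rpredZeq pnatr_eq0 -leqn0 leqNgt k_gt0.
  have fsL : f |` B `<=` @Lmonomial F n by move=> g [->|/BL].
  have : f |` B = B.
    apply: Bmax; last by move=> g Bg; right.
      by move=> g [->|/BV//]; split=> //; rewrite fw memvZ.
    apply/(convexly_independentP fsL) => t ut tfB.
    apply: (@free_sub (f :: s)) => //; first by rewrite /= free_cons fs.
    by move=> g /tfB[->|]; rewrite ?mem_head // BE in_cons => /= ->; rewrite orbT.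
  move=> fB; have : B f by rewrite -fB; left.
  by rewrite BE => fins; case/negP: fs; rewrite memv_span // map_f.
rewrite BE; have -> : \dim W = size s; last exact: card_seqset.
by have /eqP := sfree; rewrite spanW size_map.
Qed.

Lemma dconv_flat x0 W : is_dconv (flat x0 W) (\dim W).
Proof. by split; [exact: convex_basis_exists|exact: convex_basis_card]. Qed.

End ConvexDimension.

(** * Chains and factors *)

Section Chains.
Variables (R : realType) (F : nuSemifield) (log : logarithm R F) (n : nat).
Variables (u : F) (logu : log u = 1).

Local Notation S := (FLambda F n).
Local Notation val := (fval log).
Local Notation slope := (@slope R F log n).
Local Notation flat := (@flat R F log n).
Implicit Types (f g h : S) (K L M Q : set S) (s : seq S).
Implicit Types (w : 'rV[rat]_n) (W : {vspace 'rV[rat]_n}).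

(** Every member lies in the largest one, hence vanishes at [x0] and is a flat based there; strict
    inclusions become dimension jumps. *)
Lemma HSchain_flats x0 W t P : HSchain (flat x0 W) t P ->
  exists V : nat -> {vspace 'rV[rat]_n},
    [/\ forall i, (i <= t)%N -> P i = flat x0 (V i), V t = W &
        forall i, (i < t)%N -> (V i <= V i.+1)%VS /\ (\dim (V i) < \dim (V i.+1))%N].
Proof.
move=> [PH Plt Pt].
have P_sub i : (i <= t)%N -> P i `<=` P t.
  move=> it; rewrite -(subnKC it); move: (t - i)%N (subnKC it) => k.
  elim: k i {it} => [|k ih] i ikt; first by rewrite addn0.
  have it : (i < t)%N by rewrite -ikt addnS ltnS leq_addr.
  rewrite addnS -addSn; apply: subset_trans (Plt i it).1 _; apply: ih.
  by rewrite addSn -addnS.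
have /choice[V VE] : forall i, exists V, (i <= t)%N -> P i = flat x0 V.
  move=> i; have [it|_] := boolP (i <= t)%N; last by exists 0%VS.
  have [|V VE] := HSpec_flat_at logu (PH i it) (x0 := x0); last by exists V.
  by move=> f /(P_sub i it); rewrite Pt => /flat_val0.
exists V; split=> // [|i it].
  have Wt : flat x0 (V t) = flat x0 W by rewrite -VE.
  apply/eqP; rewrite eqEsubv; apply/andP.
  by split; apply/(flatS logu x0); rewrite Wt; apply: subset_refl.
have [] := Plt i it; rewrite (VE i (ltnW it)) (VE i.+1 it) => /(flatS logu) sV nsV; split=> //.
have sup := dimv_leqif_sup sV.
rewrite ltn_neqAle sup.1 andbT sup.2; apply/negP => /(flatS logu x0); exact: nsV.
Qed.

Lemma HSchain_length x0 W t P : HSchain (flat x0 W) t P -> (t <= \dim W)%N.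
Proof.
move=> /HSchain_flats[V [_ <- Vlt]].
suff : forall i, (i <= t)%N -> (i <= \dim (V i))%N by apply.
elim=> [//|i ih] it; have [_ lt] := Vlt i it.
by apply: leq_ltn_trans (ih (ltnW it)) lt.
Qed.

Lemma HSchain_exists x0 W : exists P, HSchain (flat x0 W) (\dim W) P.
Proof.
pose V i := <<take i (vbasis W)>>%VS.
have dimV i : (i <= \dim W)%N -> \dim (V i) = i.
  move=> iW; have : free (take i (vbasis W)).
    apply: (catl_free (Y := drop i (vbasis W))); rewrite cat_take_drop.
    exact: basis_free (vbasisP W).
  by move=> /eqP ->; rewrite size_takel ?size_tuple.
exists (fun i => flat x0 (V i)); split=> [i _|i iW|].
- exact: (flat_HSpec logu).
- split.
    apply/(flatS logu)/sub_span => w.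
    by rewrite -(take_takel _ (leqnSn i)); apply: mem_take.
  move=> /(flatS logu)/dimvS; rewrite (dimV i (ltnW iW)) (dimV i.+1 iW).
  by rewrite ltnn.
- by congr (flat _ _); rewrite /V take_oversize ?size_tuple // (span_basis (vbasisP W)).
Qed.

Lemma hgt_flat x0 W : is_hgt (flat x0 W) (\dim W).
Proof.
split; first exact: HSchain_exists.
by move=> [P /HSchain_length]; rewrite ltnn.
Qed.

Lemma quot_kernel_base M (Q : set (quot M)) : is_kernel M -> is_kernel Q ->
  @is_kernel S Q /\ M `<=` Q.
Proof.
move=> KM KQ; have eqvM f g : @eqv S f g -> M (fmul f (finv g)).
  move=> /(fval_eqv log) fg; apply: (ker_val (log := log) KM _ (ker1 KM)) => x.
  by rewrite fvalM fvalV fval1 fg subrr.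
split; last first.
  move=> f Mf; apply: (ker_eqv KQ _ (ker1 KQ)); rewrite /=.
  apply: (ker_val (log := log) KM _ (kerV KM Mf)) => x.
  by rewrite fvalM !fvalV fval1 add0r.
split.
- by move=> f g /eqvM; apply: (ker_eqv KQ).
- exact: ker1 KQ.
- exact: kerM KQ.
- exact: kerV KQ.
- by move=> f g v w Qf Qg /eqvM; apply: (ker_conv KQ Qf Qg).
Qed.

Lemma base_quot_kernel M K : is_kernel M -> is_kernel K -> M `<=` K ->
  @is_kernel (quot M) K.
Proof.
move=> KM KK MK; split.
- move=> f g /MK Kfg Kf; apply: (ker_val (log := log) KK _ (kerM KK Kf (kerV KK Kfg))).
  by move=> x; rewrite fvalM fvalV fvalM fvalV opprB addrC subrK.
- exact: ker1 KK.
- exact: kerM KK.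
- exact: kerV KK.
- move=> f g v w Kf Kg Mvw.
  (* In the quotient [v + w] is only congruent to 1. It lies in [K], so the weights are divided by
     it, convexity in [K] is applied, and the result is multiplied back. *)
  have [m [Km vw]] : exists m : S,
      K m /\ @eqv S (fadd (fmul (v : S) (finv m)) (fmul (w : S) (finv m))) fone.
    exists (fadd (v : S) w); split.
      apply: MK; apply: (ker_val (log := log) KM _ Mvw) => x.
      by rewrite fvalM fvalV fval1 subr0.
    apply/(fval_eqv log) => x; rewrite fval1 fvalD !fvalM !fvalV -addr_maxl -fvalD.
    exact: subrr.
  have := kerM KK Km (ker_conv KK Kf Kg vw).
  apply: (ker_val (log := log) KK) => x.
  rewrite fvalM !fvalD !fvalM !fvalV addr_maxr.
  by congr Num.max; rewrite addrA; congr (_ + _); rewrite addrC subrK.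
Qed.

(** An L-monomial vanishing at [x0] with slope in [V] but not in [U] generates the larger flat
    together with the smaller one. *)
Lemma HP_factor x0 (U V : {vspace 'rV[rat]_n}) : (U <= V)%VS -> \dim V = (\dim U).+1 ->
  HP_kernel_quot (flat x0 U) (quot_image (flat x0 U) (flat x0 V)).
Proof.
move=> UV dV; have /subvPn[w wV wU] : ~~ (V <= U)%VS.
  by rewrite -(dimv_leqif_sup UV).2 dV neq_ltn ltnS leqnn.
have w_neq0 : w != 0 by apply: contraNneq wU => ->; rewrite mem0v.
have [f [k [fL f0 k_gt0 fw]]] := Lmonomial_exists logu x0 w_neq0.
have fU : slope f \notin U by rewrite fw rpredZeq pnatr_eq0 -leqn0 leqNgt k_gt0.
have fV : slope f \in V by rewrite fw memvZ.
have KU := flat_kernel log x0 U; have KV := flat_kernel log x0 V.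
have FUV : flat x0 U `<=` flat x0 V by apply/(flatS logu).
have FVf : flat x0 V f by apply/(flat_Lmonomial logu).
exists f; split=> // [c Mfc|].
  (* A constant congruent to [f] is trivial, by evaluation at [x0]; then [f] itself would lie in the
     smaller flat. *)
  have c0 : log (sval c) = 0.
    by have := flat_val0 Mfc; rewrite fvalM fvalV fval_fconst f0 sub0r => /eqP;
       rewrite oppr_eq0 => /eqP.
  case/negP: fU; apply: (proj2 ((flat_Lmonomial logu x0 U fL).1 _)).
  apply: (ker_val (log := log) KU _ Mfc) => x.
  by rewrite fvalM fvalV fval_fconst c0 subr0.
apply/seteqP; split=> g; last first.
  move=> Hg; exists g.
    apply: Hg; first exact: base_quot_kernel.
    by move=> _ ->.
  apply: (ker_val (log := log) KU _ (ker1 KU)) => x.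
  by rewrite fvalM fvalV fval1 subrr.
move=> [h Vh gh] Q /(quot_kernel_base KU)[KQ UQ] fQ.
suff VQ : flat x0 V `<=` Q.
  apply: VQ; apply: (ker_val (log := log) KV _ (kerM KV (FUV _ gh) Vh)) => x.
  by rewrite !fvalM fvalV subrK.
have [s [sL s0 sU FU]] := flat_generators logu x0 U.
have -> : flat x0 V = kgen (seqset (f :: s)).
  rewrite (kgen_flat logu (x0 := x0)) /=.
  - congr (flat _ _); apply/eqP; rewrite span_cons (span_basis sU) eq_sym eqEdim.
    rewrite subv_add -memvE fV UV /= dV ltn_neqAle.
    have UfU : (U <= <[slope f]> + U)%VS by apply: addvSr.
    have sup := dimv_leqif_sup UfU; rewrite sup.1 sup.2 andbT.
    by rewrite subv_add -memvE (negPf fU).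
  - by move=> g'; rewrite in_cons => /orP[/eqP->|/sL].
  - by move=> g'; rewrite in_cons => /orP[/eqP->|/s0].
apply: (kgen_sub KQ); apply: seqset_cons; first by apply/mem_set/fQ.
by move=> g' gs; apply: UQ; rewrite FU; apply: sub_kgen.
Qed.

Lemma maximal_chain_factor x0 W t P i : HSchain_maximal (flat x0 W) t P -> (i < t)%N ->
  HP_kernel_quot (P i) (quot_image (P i) (P i.+1)).
Proof.
move=> [PC Pmax] it.
have tW : t = \dim W.
  apply/eqP; rewrite eqn_leq (HSchain_length PC) /=.
  by have [Q QC] := HSchain_exists x0 W; apply: Pmax QC.
have [V [PV Vt Vlt]] := HSchain_flats PC.
have lower j : (j <= t)%N -> (j <= \dim (V j))%N.
  elim: j => [//|j ih] jt; have [_ lt] := Vlt j jt.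
  by apply: leq_ltn_trans (ih (ltnW jt)) lt.
(* The dimension jumps, counted from the bottom in [lower] and from the top here, leave no slack:
   the [j]-th subspace has dimension exactly [j]. *)
have upper j : (j <= t)%N -> (\dim (V (t - j)) + j <= t)%N.
  elim: j => [|j ih] jt; first by rewrite subn0 addn0 Vt tW.
  have [|_ lt] := Vlt (t - j.+1)%N; first by rewrite ltn_subrL (leq_trans _ jt).
  move: lt; rewrite subnSK // => lt; apply: leq_trans (ih (ltnW jt)).
  by rewrite addnS -addSn leq_add2r.
have dimV j : (j <= t)%N -> \dim (V j) = j.
  move=> jt; apply/eqP; rewrite eqn_leq lower // andbT.
  have := upper (t - j)%N (leq_subr _ _); rewrite subKn // => H.
  by rewrite -(leq_add2r (t - j)%N) subnKC.
rewrite (PV i (ltnW it)) (PV i.+1 it); apply: HP_factor; first exact: (Vlt i it).1.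
by rewrite !dimV // ltnW.
Qed.

End Chains.

(** * The trivial semifield and the conclusion *)

Lemma Omega_trivial (F : nuSemifield) (n : nat) (K : set (FLambda F n)) :
  (forall a b : F, nu_eq a b) -> Omega K -> K = setT.
Proof.
move=> triv; have eqvT (f g : FLambda F n) : eqv f g by move=> x; apply: triv.
have kerT (K' : set (FLambda F n)) : is_kernel K' -> K' = setT.
  move=> KK; apply/seteqP; split=> // f _.
  exact: (ker_eqv KK (eqvT fone f) (ker1 KK)).
elim=> [|f _|K1 K2 _ -> _ ->|K1 K2 _ -> _ ->].
- exact/kerT/kgen_kernel.
- exact/kerT/kgen_kernel.
- exact: setIT.
- by apply/seteqP; split=> // f _; exists f, f.
Qed.

Local Close Scope ring_scope.

Theorem theorem3p52 (F : nuSemifield) (n : nat)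
    (Fdiv : nu_divisible F) (Farch : nu_archimedean F)
    (L : set (FLambda F n)) (hL : HSpec L) :
  (exists t : nat, is_hgt L t /\ is_dconv L t) /\
  (forall (t : nat) (P : nat -> set (FLambda F n)),
     HSchain_maximal L t P ->
     forall i : nat, i < t ->
       HP_kernel_quot (P i) (quot_image (P i) (P i.+1))).
Proof.
have [triv|[log [u [_ logu]]]] := logarithm_exists Rdefinitions.R Fdiv Farch.
  have HT (K : set (FLambda F n)) : HSpec K -> K = setT.
    by move=> [OK _ _]; apply: Omega_trivial triv OK.
  have no_step (K1 K2 : set (FLambda F n)) : HSpec K1 -> HSpec K2 -> ~ K1 `<` K2.
    by move=> /HT -> /HT -> [_]; apply; apply: subset_refl.
  split; last first.
    move=> t P [[PH Plt _] _] i it.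
    by case: (no_step _ _ (PH i (ltnW it)) (PH i.+1 it) (Plt i it)).
  (* When [F] is trivial up to [nu], all monomials are proportional; so the empty set is the only
     basis, and both dimensions are 0. *)
  have noL (f : FLambda F n) : ~ Lmonomial f.
    by move=> [h [g [hg _]]]; apply: hg; exists (tang1 F) => x; apply: triv.
  exists 0; split; split.
  - by exists (fun=> L); split.
  - by move=> [P [PH Plt _]]; apply: no_step (Plt 0 _); [apply: PH|apply: PH|].
  - exists set0; split=> // B' B'V _ _; apply/seteqP; split=> // f /B'V[fL].
    by case: (noL f).
  - move=> B [BV _ _]; rewrite II0 card_eq0; apply/eqP/seteqP; split=> // f /BV[fL].
    by case: (noL f).
have [x0 [W LE]] := HSpec_flat logu hL; rewrite LE; split.
  by exists (\dim W); split; [apply: (hgt_flat logu)|apply: (dconv_flat logu)].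
by move=> t P PC i; apply: (maximal_chain_factor logu PC).
Qed.
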